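(* Let $\lambda(z)|dz|$ be a regular conformal metric on a domain $\Omega\subseteq\mathbb{C}$ with an isolated singularity at $z=p$. Suppose that its curvature $\kappa:\Omega\to\mathbb{R}$ has a Hölder continuous extension to $\Omega\cup\{p\}$ such that $\kappa(p)<0$, and that the order of $\log\lambda$ at $z=p$ is $\alpha=1$. Then (i) $\displaystyle\lim_{z\to p}(z-p)|z-p|\log(1/|z-p|)\,\lambda_z(z)=-\frac{1}{2\sqrt{-\kappa(p)}}$, (ii) $\displaystyle\lim_{z\to p}(z-p)^2|z-p|\log(1/|z-p|)\,\lambda_{zz}(z)=\frac{3}{4\sqrt{-\kappa(p)}}$, (iii) $\displaystyle\lim_{z\to p}|z-p|^3\log(1/|z-p|)\,\lambda_{z\bar z}(z)=\frac{1}{4\sqrt{-\kappa(p)}}$.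
   Context: A conformal metric $\lambda(z)|dz|$ on a domain $\Omega\subseteq\mathbb{C}$ is regular if its density $\lambda$ is positive and twice continuously differentiable on $\Omega$; its (Gaussian) curvature is then $\kappa(z)=-\frac{\Delta\log\lambda(z)}{\lambda(z)^2}$, where $\Delta$ is the Laplace operator. That the metric has an isolated singularity at $p\in\mathbb{C}$ means that $p$ is an isolated boundary point of $\Omega$, i.e. $p\notin\Omega$ and $\Omega$ contains a punctured neighborhood of $p$. The order of $\log\lambda$ at $p$ is $\lim_{r\to0^+}\frac{\sup_{|z-p|=r}\log\lambda(z)}{\log(1/r)}$, if this limit exists. Subscripts $z,\bar z$ denote Wirtinger derivatives. *)

(* Defs.v *)
From Stdlib Require Export Reals.
From Coquelicot Require Export Coquelicot.

Open Scope R_scope.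

Definition connected (D : C -> Prop) : Prop :=
  forall U V : C -> Prop,
    open U -> open V ->
    (forall z, D z -> U z \/ V z) ->
    (exists z, D z /\ U z) -> (exists z, D z /\ V z) ->
    exists z, D z /\ U z /\ V z.

Definition domain (D : C -> Prop) : Prop :=
  open D /\ connected D /\ exists z, D z.

(* For functions on [C], "real" calculus is done in the coordinates
   [z = (Re z, Im z)].  [ex_diff_n f 2] at every point of an open set says that
   all partial derivatives of order at most 2 exist and are continuous there. *)
Definition C2_on (D : C -> Prop) (u : C -> R) : Prop :=
  forall z, D z -> ex_diff_n (fun x y => u (x, y)) 2 (Re z) (Im z).

Definition regular_metric (D : C -> Prop) (lambda : C -> R) : Prop :=
  (forall z, D z -> 0 < lambda z) /\ C2_on D lambda.

Definition isolated_boundary_point (D : C -> Prop) (p : C) : Prop :=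
  ~ D p /\ locally' p D.

Definition laplacian (u : C -> R) (z : C) : R :=
  Derive_n (fun x => u (x, Im z)) 2 (Re z)
  + Derive_n (fun y => u (Re z, y)) 2 (Im z).

Definition curvature (lambda : C -> R) (z : C) : R :=
  - laplacian (fun w => ln (lambda w)) z / (lambda z) ^ 2.

(* The case [z = w] is excluded because [Rpower 0 gamma] is a junk value. *)
Definition holder_continuous_on (D : C -> Prop) (f : C -> R) : Prop :=
  exists gamma M : R, 0 < gamma <= 1 /\
    forall z w, D z -> D w -> z <> w ->
      Rabs (f z - f w) <= M * Rpower (Cmod (z - w)) gamma.

(* [real] sends an infinite supremum to 0; this does not happen when [u] is
   continuous in a punctured neighbourhood of [p] and [r] is small. *)
Definition has_order (u : C -> R) (p : C) (alpha : R) : Prop :=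
  filterlim
    (fun r => real (Lub_Rbar (fun t => exists z, Cmod (z - p) = r /\ t = u z))
              / ln (1 / r))
    (at_right 0) (locally alpha).

Definition Cderive_x (f : C -> C) (z : C) : C :=
  (Derive (fun x => Re (f (x, Im z))) (Re z),
   Derive (fun x => Im (f (x, Im z))) (Re z)).

Definition Cderive_y (f : C -> C) (z : C) : C :=
  (Derive (fun y => Re (f (Re z, y))) (Im z),
   Derive (fun y => Im (f (Re z, y))) (Im z)).

Definition wirtinger (f : C -> C) (z : C) : C :=
  (/ 2 * (Cderive_x f z - Ci * Cderive_y f z))%C.

Definition wirtinger_bar (f : C -> C) (z : C) : C :=
  (/ 2 * (Cderive_x f z + Ci * Cderive_y f z))%C.

(* Main.v *)
Require Import Defs.
From Stdlib Require Import Lra Psatz.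

(** With [u = ln lambda], the function [U (s, t) = u (p + e^(s + i t)) + s] lives on a
    half-strip [s < S0], is [2 PI]-periodic in [t], and satisfies
    [U_ss + U_tt = k e^(2 U)] with [k = - kappa > 0] Holder continuous.
    - Comparison with explicit super- and subsolutions depending on [s] alone, as in
      Ahlfors' lemma, gives [U + ln (- s) -> - ln (- kappa p) / 2].  The upper bound holds
      for every such metric; the lower bound needs [U] to be sublinear in [s], which
      follows from the order being 1 and a Harnack inequality on circles.
    - Hence, up to an additive constant, [U] and its Laplacian tend to 0 uniformly on the
      unit disc about [(s, t)] as [s -> -oo], and interior estimates show that all first
      and second derivatives of [U] tend to 0.  The estimates come from the ODEs satisfied
      by the Fourier modes of order 0, 1, 2 on concentric circles: those of order 1 and 2
      carry the gradient and the trace-free Hessian at the centre.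
    Since [z u_z], [z^2 u_zz] and [|z|^2 u_(z zbar)] (taking [p = 0]) are polynomials in the
    derivatives of [U], they tend to [-1/2], [1/2] and [0], and
    [|z| ln (1/|z|) lambda -> 1 / sqrt (- kappa p)]. *)

(** * C^2 functions of two real variables and logarithmic polar coordinates *)

(** The order separates a cusp from a cone: near a conical point [u] behaves like
    [- alpha ln |z - p|] with [alpha < 1], so that [U] behaves like [(1 - alpha) s] and the lower
    bound fails. The order speaks only of suprema over circles, hence the Harnack step. In
    logarithmic coordinates every estimate is scale invariant: a unit disc of the strip corresponds
    to a region of size comparable to [|z - p|]. [U] is unbounded, but [ln (- s)] oscillates only by
    [O(1 / |s|)] on such a disc, so a constant depending on the disc can be subtracted. On circles
    of radius [e^s] a bounded Laplacian forces each Fourier mode at the rate [e^(2 s)]. This is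
    harmless for modes 0 and 1 but resonant for mode 2, so second derivatives require a Holder bound
    on [k e^(2 U)]. The Holder continuity of [kappa] enters there beyond mere continuity, and the
    gradient bound supplies the regularity of [e^(2 U)]. The final constants come from
    [lambda_z = lambda u_z]: a second derivative adds [u_z^2] or [|u_z|^2], so that
    [3/4 = 1/2 + (-1/2)^2] and [1/4 = 0 + (1/2)^2]. *)

Definition open2 (D : R -> R -> Prop) : Prop :=
  forall x y, D x y -> locally_2d D x y.


(** Partial derivatives are carried as explicit functions rather than as [Derive] terms, so that
    identities between derivatives of composites can be settled by [ring]. *)
Definition C1_jet (D : R -> R -> Prop) (f fx fy : R -> R -> R) : Prop :=
  forall x y, D x y ->
    is_derive (fun t => f t y) x (fx x y) /\
    is_derive (fun t => f x t) y (fy x y) /\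
    continuity_2d_pt fx x y /\ continuity_2d_pt fy x y.

(** The same [fxy] is the [y]-derivative of [fx] and the [x]-derivative of [fy]: symmetry of the
    mixed partials is built in. *)
Definition C2_jet (D : R -> R -> Prop) (f fx fy fxx fxy fyy : R -> R -> R) : Prop :=
  C1_jet D f fx fy /\ C1_jet D fx fxx fxy /\ C1_jet D fy fxy fyy.

(** Both partial derivatives exist and one of them is continuous, which is enough for the total
    differentiability that the chain rule needs. *)
Lemma C1_jet_differentiable D f fx fy x y :
  open2 D -> C1_jet D f fx fy -> D x y ->
  differentiable_pt_lim f x y (fx x y) (fy x y).
Proof.
  intros HD Hf Hxy.
  apply filterdiff_differentiable_pt_lim.
  apply (is_derive_filterdiff f x y fx (fy x y)).
  - apply (locally_2d_locally
      (fun u v => is_derive (fun z => f z v) u (fx u v)) x y).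
    destruct (HD x y Hxy) as [d Hd].
    exists d. intros u v Hu Hv. apply (Hf u v (Hd u v Hu Hv)).
  - apply (Hf x y Hxy).
  - apply continuity_2d_pt_filterlim. apply (Hf x y Hxy).
Qed.

Lemma C1_jet_continuity D f fx fy x y :
  open2 D -> C1_jet D f fx fy -> D x y -> continuity_2d_pt f x y.
Proof.
  intros HD Hf Hxy. apply differentiable_continuity_pt.
  exists (fx x y), (fy x y). now apply (C1_jet_differentiable D).
Qed.

Lemma C1_jet_chain D f fx fy (X Y : R -> R) t X' Y' :
  open2 D -> C1_jet D f fx fy -> D (X t) (Y t) ->
  is_derive X t X' -> is_derive Y t Y' ->
  is_derive (fun u => f (X u) (Y u)) t (fx (X t) (Y t) * X' + fy (X t) (Y t) * Y').
Proof.
  intros HD Hf H HX HY. apply is_derive_Reals.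
  apply derivable_pt_lim_comp_2d.
  - now apply (C1_jet_differentiable D).
  - now apply is_derive_Reals.
  - now apply is_derive_Reals.
Qed.

Lemma C1_jet_ext D f fx fy g gx gy :
  (forall x y, f x y = g x y) -> (forall x y, fx x y = gx x y) ->
  (forall x y, fy x y = gy x y) ->
  C1_jet D f fx fy -> C1_jet D g gx gy.
Proof.
  intros H Hx Hy Hf x y Hxy. destruct (Hf x y Hxy) as (H1 & H2 & H3 & H4).
  rewrite <- Hx, <- Hy. split; [|split; [|split]].
  - apply is_derive_ext with (2 := H1). intros; apply H.
  - apply is_derive_ext with (2 := H2). intros; apply H.
  - now apply continuity_2d_pt_ext with (2 := H3).
  - now apply continuity_2d_pt_ext with (2 := H4).
Qed.

Lemma C1_jet_sub (D E : R -> R -> Prop) f fx fy :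
  (forall x y, E x y -> D x y) -> C1_jet D f fx fy -> C1_jet E f fx fy.
Proof. intros H Hf x y Hxy. now apply Hf, H. Qed.

Lemma C1_jet_plus D f fx fy g gx gy :
  C1_jet D f fx fy -> C1_jet D g gx gy ->
  C1_jet D (fun x y => f x y + g x y) (fun x y => fx x y + gx x y)
    (fun x y => fy x y + gy x y).
Proof.
  intros Hf Hg x y Hxy.
  destruct (Hf x y Hxy) as (H1 & H2 & H3 & H4).
  destruct (Hg x y Hxy) as (K1 & K2 & K3 & K4).
  split; [|split; [|split]].
  - now apply (is_derive_plus (fun t => f t y) (fun t => g t y)).
  - now apply (is_derive_plus (fun t => f x t) (fun t => g x t)).
  - now apply continuity_2d_pt_plus.
  - now apply continuity_2d_pt_plus.
Qed.

Lemma C1_jet_mult D f fx fy g gx gy :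
  open2 D -> C1_jet D f fx fy -> C1_jet D g gx gy ->
  C1_jet D (fun x y => f x y * g x y)
    (fun x y => fx x y * g x y + f x y * gx x y)
    (fun x y => fy x y * g x y + f x y * gy x y).
Proof.
  intros HD Hf Hg x y Hxy.
  pose proof (C1_jet_continuity D f fx fy x y HD Hf Hxy).
  pose proof (C1_jet_continuity D g gx gy x y HD Hg Hxy).
  destruct (Hf x y Hxy) as (H1 & H2 & H3 & H4).
  destruct (Hg x y Hxy) as (K1 & K2 & K3 & K4).
  split; [|split; [|split]].
  - apply (is_derive_mult (fun t => f t y) (fun t => g t y)); try easy.
    intros; apply Rmult_comm.
  - apply (is_derive_mult (fun t => f x t) (fun t => g x t)); try easy.
    intros; apply Rmult_comm.
  - apply continuity_2d_pt_plus; now apply continuity_2d_pt_mult.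
  - apply continuity_2d_pt_plus; now apply continuity_2d_pt_mult.
Qed.

Lemma C1_jet_const D c : C1_jet D (fun _ _ => c) (fun _ _ => 0) (fun _ _ => 0).
Proof.
  intros x y _. split; [|split; [|split]]; try apply continuity_2d_pt_const;
  apply (is_derive_const (K := R_AbsRing) (V := R_NormedModule)).
Qed.

Lemma C1_jet_opp D f fx fy :
  C1_jet D f fx fy ->
  C1_jet D (fun x y => - f x y) (fun x y => - fx x y) (fun x y => - fy x y).
Proof.
  intros Hf x y Hxy. destruct (Hf x y Hxy) as (H1 & H2 & H3 & H4).
  split; [|split; [|split]].
  - now apply (is_derive_opp (fun t => f t y)).
  - now apply (is_derive_opp (fun t => f x t)).
  - now apply continuity_2d_pt_opp.
  - now apply continuity_2d_pt_opp.
Qed.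

Lemma C1_jet_comp D f fx fy h h' :
  open2 D -> C1_jet D f fx fy ->
  (forall x y, D x y -> is_derive h (f x y) (h' (f x y)) /\ continuity_pt h' (f x y)) ->
  C1_jet D (fun x y => h (f x y)) (fun x y => h' (f x y) * fx x y)
    (fun x y => h' (f x y) * fy x y).
Proof.
  intros HD Hf Hh x y Hxy.
  pose proof (C1_jet_continuity D f fx fy x y HD Hf Hxy).
  destruct (Hf x y Hxy) as (H1 & H2 & H3 & H4).
  destruct (Hh x y Hxy) as [K1 K2].
  split; [|split; [|split]].
  - rewrite Rmult_comm. now apply (is_derive_comp h (fun t => f t y)).
  - rewrite Rmult_comm. now apply (is_derive_comp h (fun t => f x t)).
  - apply continuity_2d_pt_mult; [|easy].
    now apply (continuity_1d_2d_pt_comp h' f).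
  - apply continuity_2d_pt_mult; [|easy].
    now apply (continuity_1d_2d_pt_comp h' f).
Qed.

Lemma continuity_2d_pt_1d_1 (h : R -> R) x y :
  continuity_pt h x -> continuity_2d_pt (fun u _ => h u) x y.
Proof.
  intros H. apply (continuity_1d_2d_pt_comp h (fun u _ => u)); [easy|].
  apply continuity_2d_pt_id1.
Qed.

Lemma continuity_2d_pt_1d_2 (h : R -> R) x y :
  continuity_pt h y -> continuity_2d_pt (fun _ v => h v) x y.
Proof.
  intros H. apply (continuity_1d_2d_pt_comp h (fun _ v => v)); [easy|].
  apply continuity_2d_pt_id2.
Qed.

Lemma continuity_pt_is_derive (h : R -> R) x l : is_derive h x l -> continuity_pt h x.
Proof.
  intros H. apply derivable_continuous_pt. exists l. now apply is_derive_Reals.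
Qed.

Lemma C1_jet_exp_cos D :
  C1_jet D (fun s t => exp s * cos t) (fun s t => exp s * cos t)
    (fun s t => - (exp s * sin t)).
Proof.
  assert (Hc : forall s t, continuity_2d_pt (fun s t => exp s * cos t) s t).
  { intros s t. apply continuity_2d_pt_mult.
    - apply continuity_2d_pt_1d_1, derivable_continuous_pt, derivable_pt_exp.
    - apply continuity_2d_pt_1d_2, continuity_cos. }
  assert (Hs : forall s t, continuity_2d_pt (fun s t => exp s * sin t) s t).
  { intros s t. apply continuity_2d_pt_mult.
    - apply continuity_2d_pt_1d_1, derivable_continuous_pt, derivable_pt_exp.
    - apply continuity_2d_pt_1d_2, continuity_sin. }
  intros s t _. split; [|split; [|split]].
  - auto_derive; trivial; ring.
  - auto_derive; trivial; ring.
  - apply Hc.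
  - apply continuity_2d_pt_opp, Hs.
Qed.

Lemma C1_jet_exp_sin D :
  C1_jet D (fun s t => exp s * sin t) (fun s t => exp s * sin t)
    (fun s t => exp s * cos t).
Proof.
  assert (Hc : forall s t, continuity_2d_pt (fun s t => exp s * cos t) s t).
  { intros s t. apply continuity_2d_pt_mult.
    - apply continuity_2d_pt_1d_1, derivable_continuous_pt, derivable_pt_exp.
    - apply continuity_2d_pt_1d_2, continuity_cos. }
  assert (Hs : forall s t, continuity_2d_pt (fun s t => exp s * sin t) s t).
  { intros s t. apply continuity_2d_pt_mult.
    - apply continuity_2d_pt_1d_1, derivable_continuous_pt, derivable_pt_exp.
    - apply continuity_2d_pt_1d_2, continuity_sin. }
  intros s t _. split; [|split; [|split]].
  - auto_derive; trivial; ring.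
  - auto_derive; trivial; ring.
  - apply Hs.
  - apply Hc.
Qed.

Lemma continuity_2d_pt_comp2 (f g h : R -> R -> R) x y :
  continuity_2d_pt f (g x y) (h x y) -> continuity_2d_pt g x y ->
  continuity_2d_pt h x y -> continuity_2d_pt (fun u v => f (g u v) (h u v)) x y.
Proof.
  intros Hf Hg Hh eps. destruct (Hf eps) as [d Hd].
  destruct (Hg d) as [d1 H1]. destruct (Hh d) as [d2 H2].
  assert (Hm : 0 < Rmin d1 d2) by (apply Rmin_pos; apply cond_pos).
  exists (mkposreal _ Hm). simpl. intros u v Hu Hv. apply Hd.
  - apply H1; eapply Rlt_le_trans; eauto using Rmin_l.
  - apply H2; eapply Rlt_le_trans; eauto using Rmin_r.
Qed.

(** Pullback by [c + e^(s + i t)]. It serves twice: about the singularity it produces the strip, and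
    about a point of the strip it produces the concentric circles of the interior estimates. *)
Definition logpolar (cx cy : R) (f : R -> R -> R) (s t : R) : R :=
  f (cx + exp s * cos t) (cy + exp s * sin t).

Definition logpolar_dom (cx cy : R) (D : R -> R -> Prop) (s t : R) : Prop :=
  D (cx + exp s * cos t) (cy + exp s * sin t).

Lemma C1_jet_center_x cx D :
  C1_jet D (fun s t => cx + exp s * cos t) (fun s t => exp s * cos t)
    (fun s t => - (exp s * sin t)).
Proof.
  apply C1_jet_ext with (4 := C1_jet_plus _ _ _ _ _ _ _
    (C1_jet_const D cx) (C1_jet_exp_cos D)); intros; ring.
Qed.

Lemma C1_jet_center_y cy D :
  C1_jet D (fun s t => cy + exp s * sin t) (fun s t => exp s * sin t)
    (fun s t => exp s * cos t).
Proof.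
  apply C1_jet_ext with (4 := C1_jet_plus _ _ _ _ _ _ _
    (C1_jet_const D cy) (C1_jet_exp_sin D)); intros; ring.
Qed.

Lemma open2_true : open2 (fun _ _ => True).
Proof. intros x y _. exists (mkposreal 1 Rlt_0_1). easy. Qed.

Lemma continuity_2d_pt_logpolar cx cy f s t :
  continuity_2d_pt f (cx + exp s * cos t) (cy + exp s * sin t) ->
  continuity_2d_pt (logpolar cx cy f) s t.
Proof.
  intros H. apply (continuity_2d_pt_comp2 f); [exact H| |].
  - exact (C1_jet_continuity _ _ _ _ s t open2_true (C1_jet_center_x cx _) I).
  - exact (C1_jet_continuity _ _ _ _ s t open2_true (C1_jet_center_y cy _) I).
Qed.

Lemma open2_logpolar cx cy D : open2 D -> open2 (logpolar_dom cx cy D).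
Proof.
  intros HD s t H. destruct (HD _ _ H) as [d Hd].
  destruct (C1_jet_continuity _ _ _ _ s t open2_true (C1_jet_center_x cx _) I d) as [d1 H1].
  destruct (C1_jet_continuity _ _ _ _ s t open2_true (C1_jet_center_y cy _) I d) as [d2 H2].
  assert (Hm : 0 < Rmin d1 d2) by (apply Rmin_pos; apply cond_pos).
  exists (mkposreal _ Hm). simpl. intros u v Hu Hv. apply Hd.
  - apply H1; eapply Rlt_le_trans; eauto using Rmin_l.
  - apply H2; eapply Rlt_le_trans; eauto using Rmin_r.
Qed.

Lemma C1_jet_logpolar cx cy D f fx fy :
  open2 D -> C1_jet D f fx fy ->
  C1_jet (logpolar_dom cx cy D) (logpolar cx cy f)
    (fun s t => exp s * cos t * logpolar cx cy fx s t
                + exp s * sin t * logpolar cx cy fy s t)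
    (fun s t => - (exp s * sin t) * logpolar cx cy fx s t
                + exp s * cos t * logpolar cx cy fy s t).
Proof.
  intros HD Hf s t Hst.
  destruct (Hf _ _ Hst) as (H1 & H2 & H3 & H4).
  destruct (C1_jet_center_x cx (fun _ _ => True) s t I) as (X1 & X2 & X3 & X4).
  destruct (C1_jet_center_y cy (fun _ _ => True) s t I) as (Y1 & Y2 & Y3 & Y4).
  split; [|split; [|split]].
  - evar_last.
    + exact (C1_jet_chain D f fx fy (fun s => cx + exp s * cos t)
        (fun s => cy + exp s * sin t) s _ _ HD Hf Hst X1 Y1).
    + unfold logpolar; ring.
  - evar_last.
    + exact (C1_jet_chain D f fx fy (fun t => cx + exp s * cos t)
        (fun t => cy + exp s * sin t) t _ _ HD Hf Hst X2 Y2).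
    + unfold logpolar; ring.
  - apply continuity_2d_pt_plus; apply continuity_2d_pt_mult; trivial;
      now apply continuity_2d_pt_logpolar.
  - apply continuity_2d_pt_plus; apply continuity_2d_pt_mult; trivial;
      now apply continuity_2d_pt_logpolar.
Qed.

(** Derivatives of the pullback. With [x = e^s cos t] and [y = e^s sin t] one has [x_s = x],
    [x_t = - y], [y_s = y], [y_t = x]; hence each second derivative is a quadratic form in [x], [y]
    plus a first-order remainder. *)
Definition lp_s cx cy (fx fy : R -> R -> R) s t :=
  exp s * cos t * logpolar cx cy fx s t + exp s * sin t * logpolar cx cy fy s t.
Definition lp_t cx cy (fx fy : R -> R -> R) s t :=
  - (exp s * sin t) * logpolar cx cy fx s t + exp s * cos t * logpolar cx cy fy s t.
Definition lp_ss cx cy (fx fy fxx fxy fyy : R -> R -> R) s t :=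
  lp_s cx cy fx fy s t
  + ((exp s * cos t) ^ 2 * logpolar cx cy fxx s t
     + 2 * (exp s * cos t) * (exp s * sin t) * logpolar cx cy fxy s t
     + (exp s * sin t) ^ 2 * logpolar cx cy fyy s t).
Definition lp_st cx cy (fx fy fxx fxy fyy : R -> R -> R) s t :=
  lp_t cx cy fx fy s t
  + ((exp s * cos t) * (exp s * sin t)
       * (logpolar cx cy fyy s t - logpolar cx cy fxx s t)
     + ((exp s * cos t) ^ 2 - (exp s * sin t) ^ 2) * logpolar cx cy fxy s t).
Definition lp_tt cx cy (fx fy fxx fxy fyy : R -> R -> R) s t :=
  - lp_s cx cy fx fy s t
  + ((exp s * sin t) ^ 2 * logpolar cx cy fxx s t
     - 2 * (exp s * cos t) * (exp s * sin t) * logpolar cx cy fxy s t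
     + (exp s * cos t) ^ 2 * logpolar cx cy fyy s t).

Lemma C2_jet_logpolar cx cy D f fx fy fxx fxy fyy :
  open2 D -> C2_jet D f fx fy fxx fxy fyy ->
  C2_jet (logpolar_dom cx cy D) (logpolar cx cy f)
    (lp_s cx cy fx fy) (lp_t cx cy fx fy)
    (lp_ss cx cy fx fy fxx fxy fyy) (lp_st cx cy fx fy fxx fxy fyy)
    (lp_tt cx cy fx fy fxx fxy fyy).
Proof.
  intros HD (Hf & Hfx & Hfy).
  pose proof (open2_logpolar cx cy D HD) as HD'.
  pose proof (C1_jet_logpolar cx cy _ _ _ _ HD Hfx) as Jx.
  pose proof (C1_jet_logpolar cx cy _ _ _ _ HD Hfy) as Jy.
  pose proof (C1_jet_exp_cos (logpolar_dom cx cy D)) as JA.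
  pose proof (C1_jet_exp_sin (logpolar_dom cx cy D)) as JB.
  split; [|split].
  - now apply C1_jet_logpolar.
  - apply C1_jet_ext with (4 := C1_jet_plus _ _ _ _ _ _ _
      (C1_jet_mult _ _ _ _ _ _ _ HD' JA Jx) (C1_jet_mult _ _ _ _ _ _ _ HD' JB Jy));
    intros; unfold lp_s, lp_ss, lp_st, lp_s, lp_t; ring.
  - apply C1_jet_ext with (4 := C1_jet_plus _ _ _ _ _ _ _
      (C1_jet_mult _ _ _ _ _ _ _ HD' (C1_jet_opp _ _ _ _ JB) Jx)
      (C1_jet_mult _ _ _ _ _ _ _ HD' JA Jy));
    intros; unfold lp_t, lp_tt, lp_st, lp_s, lp_t; ring.
Qed.

(** Conformal invariance: the first-order remainders cancel and the Laplacian is multiplied by the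
    squared modulus [e^(2 s)] of the derivative of the map. *)
Lemma lp_laplacian cx cy fx fy fxx fxy fyy s t :
  lp_ss cx cy fx fy fxx fxy fyy s t + lp_tt cx cy fx fy fxx fxy fyy s t
  = exp (2 * s) * logpolar cx cy (fun x y => fxx x y + fyy x y) s t.
Proof.
  unfold lp_ss, lp_tt, logpolar.
  replace (2 * s) with (s + s) by ring. rewrite exp_plus.
  pose proof (sin2_cos2 t) as H. unfold Rsqr in H.
  match goal with |- _ = exp s * exp s * ?F =>
    replace (exp s * exp s * F) with
     (exp s * exp s * (sin t * sin t + cos t * cos t) * F) by (rewrite H; ring) end.
  ring.
Qed.

(** * Fourier modes on concentric circles *)

Lemma is_lim_m_infty_eps f l :
  is_lim f m_infty (Finite l) <->
  forall eps, 0 < eps -> exists S, forall s, s < S -> Rabs (f s - l) < eps.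
Proof.
  split.
  - intros H eps He. apply is_lim_spec in H.
    destruct (H (mkposreal eps He)) as [S HS]. now exists S.
  - intros H. apply is_lim_spec. intros eps.
    destruct (H eps (cond_pos eps)) as [S HS]. now exists S.
Qed.

Lemma exp_small eps : 0 < eps -> exists S, S <= 0 /\ forall s, s < S -> exp s < eps.
Proof.
  intros He. exists (Rmin 0 (ln eps)). split; [apply Rmin_l|].
  intros s Hs. rewrite <- (exp_ln eps He). apply exp_increasing.
  apply Rlt_le_trans with (1 := Hs), Rmin_r.
Qed.

Lemma is_lim_exp_scal_m_infty c : 0 < c -> is_lim (fun s => exp (c * s)) m_infty 0.
Proof.
  intros Hc. apply is_lim_m_infty_eps. intros eps He.
  destruct (exp_small eps He) as (S & _ & HS). exists (S / c). intros s Hs.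
  rewrite Rminus_0_r, Rabs_pos_eq by (left; apply exp_pos).
  apply HS. apply Rmult_lt_compat_r with (r := c) in Hs; [|easy].
  replace S with (S / c * c) by (field; lra). lra.
Qed.

Lemma nondecreasing_of_derive_nonneg (f f' : R -> R) a b :
  a <= b -> (forall x, a <= x <= b -> is_derive f x (f' x)) ->
  (forall x, a <= x <= b -> 0 <= f' x) -> f a <= f b.
Proof.
  intros Hab Hd Hp.
  destruct (MVT_gen f a b f') as (c & Hc & E).
  - rewrite Rmin_left, Rmax_right by easy. intros x Hx; apply Hd; lra.
  - rewrite Rmin_left, Rmax_right by easy. intros x Hx.
    apply continuity_pt_is_derive with (f' x), Hd; lra.
  - rewrite Rmin_left, Rmax_right in Hc by easy. specialize (Hp c Hc). nra.
Qed.

(** Both [K / beta e^(beta x) + f] and [K / beta e^(beta x) - f] are nondecreasing, which compares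
    [f s] with [f s0]; then [s0] tends to minus infinity. *)
Lemma exp_decay_bound (f f' : R -> R) K beta S l :
  0 < beta ->
  (forall s, s <= S -> is_derive f s (f' s)) ->
  (forall s, s <= S -> Rabs (f' s) <= K * exp (beta * s)) ->
  is_lim f m_infty (Finite l) ->
  forall s, s <= S -> Rabs (f s - l) <= K / beta * exp (beta * s).
Proof.
  intros Hb Hd HK Hl s Hs.
  assert (HK0 : 0 <= K).
  { specialize (HK s Hs). pose proof (Rabs_pos (f' s)).
    pose proof (exp_pos (beta * s)). nra. }
  assert (Hg : forall s0, s0 <= s ->
    Rabs (f s - f s0) <= K / beta * exp (beta * s)).
  { intros s0 Hs0.
    assert (Hkb : 0 <= K / beta * exp (beta * s0)).
    { apply Rmult_le_pos; [|left; apply exp_pos]. now apply Rdiv_le_0_compat. }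
    assert (Hde : forall x, is_derive (fun x => K / beta * exp (beta * x)) x (K * exp (beta * x))).
    { intros x. auto_derive; trivial. field; lra. }
    apply Rabs_le. split.
    - enough (f s0 + K / beta * exp (beta * s0) <= f s + K / beta * exp (beta * s)) by lra.
      apply (nondecreasing_of_derive_nonneg
        (fun x => f x + K / beta * exp (beta * x)) (fun x => f' x + K * exp (beta * x))); trivial.
      + intros x Hx. apply (is_derive_plus f); [apply Hd; lra|apply Hde].
      + intros x Hx. assert (Hx' : x <= S) by lra. specialize (HK x Hx').
        apply Rabs_le_between in HK. lra.
    - enough (K / beta * exp (beta * s0) - f s0 <= K / beta * exp (beta * s) - f s) by lra.
      apply (nondecreasing_of_derive_nonneg
        (fun x => K / beta * exp (beta * x) - f x) (fun x => K * exp (beta * x) - f' x)); trivial.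
      + intros x Hx. apply (is_derive_minus (fun x => K / beta * exp (beta * x)) f); [apply Hde|apply Hd; lra].
      + intros x Hx. assert (Hx' : x <= S) by lra. specialize (HK x Hx').
        apply Rabs_le_between in HK. lra. }
  apply le_epsilon. intros eps He.
  destruct (proj1 (is_lim_m_infty_eps f l) Hl eps He) as [S' HS'].
  set (s0 := Rmin s (S' - 1)).
  assert (H1 : s0 <= s) by apply Rmin_l.
  assert (H2 : s0 < S') by (apply Rle_lt_trans with (1 := Rmin_r _ _); lra).
  specialize (Hg s0 H1). specialize (HS' s0 H2).
  replace (f s - l) with ((f s - f s0) + (f s0 - l)) by ring.
  apply Rle_trans with (1 := Rabs_triang _ _). lra.
Qed.

(* In terms of [r = exp s] this is the equation [r^2 a'' + r a' - m^2 a = O(r^beta)]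
   of a Fourier mode; it factors through [q = exp (m s) * (a' - m a)]. *)
Lemma mode_first_order (a a1 a2 : R -> R) m K beta :
  0 <= m -> 0 < beta ->
  (forall s, s <= 0 -> is_derive a s (a1 s)) ->
  (forall s, s <= 0 -> is_derive a1 s (a2 s)) ->
  (forall s, s <= 0 -> Rabs (a2 s - m ^ 2 * a s) <= K * exp (beta * s)) ->
  is_lim (fun s => a1 s - m * a s) m_infty 0 ->
  forall s, s <= 0 -> Rabs (a1 s - m * a s) <= K / (m + beta) * exp (beta * s).
Proof.
  intros Hm Hb Ha Ha1 HK Hl s Hs.
  pose proof (exp_decay_bound (fun s => exp (m * s) * (a1 s - m * a s))
    (fun s => exp (m * s) * (a2 s - m ^ 2 * a s)) K (m + beta) 0 0) as H.
  assert (Hq : forall s, s <= 0 ->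
    Rabs (exp (m * s) * (a1 s - m * a s) - 0) <= K / (m + beta) * exp ((m + beta) * s)).
  { apply H; clear H.
    - lra.
    - intros x Hx. evar_last.
      + apply (is_derive_mult (fun s => exp (m * s)) (fun s => a1 s - m * a s)).
        * auto_derive; trivial.
        * apply (is_derive_minus a1 (fun s => m * a s)); [now apply Ha1|].
          apply is_derive_scal. now apply Ha.
        * intros; apply Rmult_comm.
      + unfold minus, plus, mult, opp; simpl. ring.
    - intros x Hx. rewrite Rabs_mult, (Rabs_pos_eq (exp _)) by (left; apply exp_pos).
      replace ((m + beta) * x) with (m * x + beta * x) by ring. rewrite exp_plus.
      specialize (HK x Hx). pose proof (exp_pos (m * x)). nra.
    - apply is_lim_m_infty_eps. intros eps He.
      destruct (proj1 (is_lim_m_infty_eps _ _) Hl eps He) as [S HS].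
      exists (Rmin S 0). intros x Hx.
      assert (x < S) by (apply Rlt_le_trans with (1 := Hx), Rmin_l).
      assert (x < 0) by (apply Rlt_le_trans with (1 := Hx), Rmin_r).
      specialize (HS x H). rewrite Rminus_0_r in HS |- *.
      rewrite Rabs_mult, (Rabs_pos_eq (exp _)) by (left; apply exp_pos).
      assert (exp (m * x) <= 1).
      { rewrite <- exp_0. assert (E : m * x <= 0) by nra.
        destruct E as [E|E]; [left; now apply exp_increasing|rewrite E; lra]. }
      pose proof (Rabs_pos (a1 x - m * a x)). nra. }
  specialize (Hq s Hs). rewrite Rminus_0_r, Rabs_mult, (Rabs_pos_eq (exp _)) in Hq
    by (left; apply exp_pos).
  replace ((m + beta) * s) with (m * s + beta * s) in Hq by ring. rewrite exp_plus in Hq.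
  apply Rmult_le_reg_l with (exp (m * s)); [apply exp_pos|]. lra.
Qed.

(** The second factor of the equation: the derivative of [e^(- m s) a] is [e^(- m s) (a' - m a)],
    which decays at the rate [beta - m]. The number [b0] is the coefficient of the solution
    [e^(m s)] regular at the centre, and [s = 0] is the unit circle. At [beta = m] the estimate
    degenerates. *)
Lemma mode_estimate (a a1 a2 : R -> R) m K beta b0 :
  0 <= m < beta ->
  (forall s, s <= 0 -> is_derive a s (a1 s)) ->
  (forall s, s <= 0 -> is_derive a1 s (a2 s)) ->
  (forall s, s <= 0 -> Rabs (a2 s - m ^ 2 * a s) <= K * exp (beta * s)) ->
  is_lim (fun s => a1 s - m * a s) m_infty 0 ->
  is_lim (fun s => exp (- m * s) * a s) m_infty (Finite b0) ->
  Rabs (a 0 - b0) <= K / (m + beta) / (beta - m).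
Proof.
  intros Hm Ha Ha1 HK Hl Hb.
  assert (H := mode_first_order a a1 a2 m K beta ltac:(lra) ltac:(lra) Ha Ha1 HK Hl).
  pose proof (exp_decay_bound (fun s => exp (- m * s) * a s)
    (fun s => exp (- m * s) * (a1 s - m * a s)) (K / (m + beta)) (beta - m) 0 b0) as H2.
  assert (H3 : Rabs (exp (- m * 0) * a 0 - b0)
               <= K / (m + beta) / (beta - m) * exp ((beta - m) * 0)).
  { apply H2; clear H2; trivial; try lra.
    - intros x Hx. evar_last.
      + apply (is_derive_mult (fun s => exp (- m * s)) a).
        * auto_derive; trivial.
        * now apply Ha.
        * intros; apply Rmult_comm.
      + unfold plus, mult; simpl. ring.
    - intros x Hx. rewrite Rabs_mult, (Rabs_pos_eq (exp _)) by (left; apply exp_pos).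
      replace ((beta - m) * x) with (- m * x + beta * x) by ring. rewrite exp_plus.
      specialize (H x Hx). pose proof (exp_pos (- m * x)). nra. }
  rewrite !Rmult_0_r, exp_0, Rmult_1_l, Rmult_1_r in H3. exact H3.
Qed.

(** * Fourier coefficients on circles, as functions of the logarithmic radius *)

Definition circ (W : R -> R -> R) (phi : R -> R) (s : R) : R :=
  RInt (fun t => W s t * phi t) 0 (2 * PI).

Lemma two_PI_pos : 0 < 2 * PI.
Proof. pose proof PI_RGT_0; lra. Qed.

Lemma continuity_2d_pt_slice f x y : continuity_2d_pt f x y -> continuity_pt (f x) y.
Proof.
  intros H. apply continuity_pt_filterlim.
  apply filterlim_locally. intros eps. destruct (H eps) as [d Hd].
  exists d. intros v Hv. apply Hd; [|exact Hv].
  rewrite Rminus_diag, Rabs_R0. apply cond_pos.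
Qed.

Lemma circ_ex W phi s :
  (forall t, continuity_2d_pt W s t) -> continuity phi ->
  ex_RInt (fun t => W s t * phi t) 0 (2 * PI).
Proof.
  intros HW Hphi. apply (ex_RInt_continuous (V := R_CompleteNormedModule)).
  intros t _. apply continuity_pt_filterlim.
  apply continuity_pt_mult; [|apply Hphi].
  apply (continuity_2d_pt_slice _ _ _ (HW t)).
Qed.

Lemma circ_bound W phi s M :
  (forall t, continuity_2d_pt W s t) -> continuity phi ->
  (forall t, Rabs (phi t) <= 1) -> (forall t, Rabs (W s t) <= M) ->
  Rabs (circ W phi s) <= 2 * PI * M.
Proof.
  intros HW Hphi H1 HM.
  replace (2 * PI * M) with ((2 * PI - 0) * M) by ring.
  apply abs_RInt_le_const.
  - left; apply two_PI_pos.
  - now apply circ_ex.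
  - intros t _. rewrite Rabs_mult. specialize (H1 t). specialize (HM t).
    pose proof (Rabs_pos (phi t)). pose proof (Rabs_pos (W s t)). nra.
Qed.

Lemma circ_plus V W phi s :
  (forall t, continuity_2d_pt V s t) -> (forall t, continuity_2d_pt W s t) ->
  continuity phi ->
  circ (fun s t => V s t + W s t) phi s = circ V phi s + circ W phi s.
Proof.
  intros HV HW Hphi. unfold circ.
  rewrite <- (RInt_plus (V := R_CompleteNormedModule)) by now apply circ_ex.
  apply RInt_ext. intros t _. unfold plus; simpl. ring.
Qed.

Lemma circ_scal c W phi s :
  (forall t, continuity_2d_pt W s t) -> continuity phi ->
  circ (fun s t => c s * W s t) phi s = c s * circ W phi s.
Proof.
  intros HW Hphi. unfold circ.
  rewrite <- (RInt_scal (V := R_CompleteNormedModule)) by now apply circ_ex.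
  apply RInt_ext. intros t _. unfold scal; simpl; unfold mult; simpl. ring.
Qed.

Lemma open2_half_plane A : open2 (fun s _ => s < A).
Proof.
  intros x y Hx. assert (Hp : 0 < A - x) by lra. exists (mkposreal _ Hp).
  simpl. intros u v Hu _. apply Rabs_lt_between in Hu. lra.
Qed.

Lemma circ_derive S W Ws Wt phi s :
  C1_jet (fun s _ => s < S) W Ws Wt -> continuity phi -> s < S ->
  is_derive (circ W phi) s (circ Ws phi s).
Proof.
  intros HW Hphi Hs.
  assert (HD := open2_half_plane S).
  assert (Hd : forall x t, x < S ->
    is_derive (fun x => W x t * phi t) x (Ws x t * phi t)).
  { intros x t Hx. evar_last.
    - apply (is_derive_mult (fun x => W x t) (fun _ => phi t)).
      + apply (HW x t Hx).
      + apply (is_derive_const (K := R_AbsRing) (V := R_NormedModule)).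
      + intros; apply Rmult_comm.
    - unfold plus, mult, zero; simpl. ring. }
  assert (Hl : locally s (fun x => x < S)) by now apply (open_lt S).
  evar_last.
  - unfold circ. apply (is_derive_RInt_param (fun x t => W x t * phi t)).
    + apply filter_imp with (2 := Hl). intros x Hx t _. eexists. now apply Hd.
    + intros t _.
      apply continuity_2d_pt_ext_loc with (fun x t => Ws x t * phi t).
      * destruct (HD s t Hs) as [d Hd']. exists d. intros u v Hu Hv.
        symmetry. apply is_derive_unique. apply Hd. now apply (Hd' u v).
      * apply continuity_2d_pt_mult; [apply (HW s t Hs)|].
        apply continuity_2d_pt_1d_2, Hphi.
    + apply filter_imp with (2 := Hl). intros x Hx. apply circ_ex; [|easy].
      intros t. exact (C1_jet_continuity _ _ _ _ x t HD HW Hx).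
  - apply RInt_ext. intros t _. apply is_derive_unique. now apply Hd.
Qed.

(** Two integrations by parts done at once: [Wt phi - W phi1] is a primitive of
    [Wtt phi + m^2 W phi], and it takes equal values at both ends of the period. *)
Lemma circ_by_parts W Wt Wtt (phi phi1 : R -> R) m s :
  (forall t, is_derive (W s) t (Wt s t)) ->
  (forall t, is_derive (Wt s) t (Wtt s t)) ->
  (forall t, continuity_2d_pt W s t) ->
  (forall t, continuity_2d_pt Wtt s t) ->
  (forall t, is_derive phi t (phi1 t)) ->
  (forall t, is_derive phi1 t (- m ^ 2 * phi t)) ->
  W s (2 * PI) = W s 0 -> Wt s (2 * PI) = Wt s 0 ->
  phi (2 * PI) = phi 0 -> phi1 (2 * PI) = phi1 0 ->
  circ Wtt phi s = - m ^ 2 * circ W phi s.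
Proof.
  intros HW HWt HWc HWttc Hphi Hphi1 E1 E2 E3 E4.
  assert (Cphi : continuity phi).
  { intros t. now apply continuity_pt_is_derive with (phi1 t). }
  assert (H : is_RInt (fun t => Wtt s t * phi t + m ^ 2 * (W s t * phi t)) 0 (2 * PI) 0).
  { evar_last.
    - apply (is_RInt_derive (fun t => Wt s t * phi t - W s t * phi1 t)).
      + intros t _. evar_last.
        * apply (is_derive_minus (fun t => Wt s t * phi t) (fun t => W s t * phi1 t)).
          -- apply (is_derive_mult (Wt s) phi); trivial. intros; apply Rmult_comm.
          -- apply (is_derive_mult (W s) phi1); trivial. intros; apply Rmult_comm.
        * unfold minus, plus, opp, mult; simpl. ring.
      + intros t _. apply continuity_pt_filterlim.
        apply continuity_pt_plus; apply continuity_pt_mult; try apply Cphi.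
        * apply (continuity_2d_pt_slice _ _ _ (HWttc t)).
        * apply continuity_pt_const. intros ? ?; reflexivity.
        * apply continuity_pt_mult; [|apply Cphi].
          apply (continuity_2d_pt_slice _ _ _ (HWc t)).
    - rewrite E1, E2, E3, E4. unfold minus, plus, opp; simpl. ring. }
  apply (is_RInt_unique (V := R_CompleteNormedModule)) in H.
  enough (circ Wtt phi s + m ^ 2 * circ W phi s = 0) by lra.
  rewrite <- H. unfold circ.
  rewrite <- (RInt_scal (V := R_CompleteNormedModule)) by now apply circ_ex.
  rewrite <- (RInt_plus (V := R_CompleteNormedModule)).
  - reflexivity.
  - now apply circ_ex.
  - apply (ex_RInt_scal (V := R_NormedModule)). now apply circ_ex.
Qed.

(** The circles of radius [e^s] shrink to the centre, where [H] is continuous; the coefficient of a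
    constant is that constant times the integral of [psi]. *)
Lemma circ_lim cx cy S H psi :
  continuity_2d_pt H cx cy ->
  (forall s t, s < S -> continuity_2d_pt (logpolar cx cy H) s t) ->
  continuity psi -> (forall t, Rabs (psi t) <= 1) ->
  is_lim (circ (logpolar cx cy H) psi) m_infty (H cx cy * RInt psi 0 (2 * PI)).
Proof.
  intros H0 Hc Hpsi Hb. apply is_lim_m_infty_eps. intros eps He.
  pose proof two_PI_pos as Hpi.
  assert (He' : 0 < eps / (2 * PI) / 2).
  { apply Rdiv_lt_0_compat; [|lra]. now apply Rdiv_lt_0_compat. }
  destruct (H0 (mkposreal _ He')) as [d Hd]. simpl in Hd.
  destruct (exp_small d (cond_pos d)) as (S' & _ & HS').
  exists (Rmin S S'). intros s Hs.
  assert (Hs1 : s < S) by (apply Rlt_le_trans with (1 := Hs), Rmin_l).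
  assert (Hs2 : exp s < d) by (apply HS', Rlt_le_trans with (1 := Hs), Rmin_r).
  replace (circ (logpolar cx cy H) psi s - H cx cy * RInt psi 0 (2 * PI))
    with (circ (fun s t => logpolar cx cy H s t + - H cx cy) psi s).
  - apply Rle_lt_trans with (2 * PI * (eps / (2 * PI) / 2)).
    + apply circ_bound; trivial.
      * intros t. apply continuity_2d_pt_plus; [now apply Hc|].
        apply continuity_2d_pt_const.
      * intros t. left. unfold logpolar. apply Hd.
        -- replace (cx + exp s * cos t - cx) with (exp s * cos t) by ring.
           rewrite Rabs_mult, (Rabs_pos_eq (exp s)) by (left; apply exp_pos).
           pose proof (exp_pos s).
           assert (Rabs (cos t) <= 1) by (apply Rabs_le, COS_bound). nra.
        -- replace (cy + exp s * sin t - cy) with (exp s * sin t) by ring.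
           rewrite Rabs_mult, (Rabs_pos_eq (exp s)) by (left; apply exp_pos).
           pose proof (exp_pos s).
           assert (Rabs (sin t) <= 1) by (apply Rabs_le, SIN_bound). nra.
    + field_simplify; lra.
  - rewrite circ_plus; trivial.
    + unfold Rminus. f_equal. unfold circ.
      rewrite Ropp_mult_distr_l.
      apply (RInt_scal (V := R_CompleteNormedModule) psi).
      apply (ex_RInt_continuous (V := R_CompleteNormedModule)).
      intros t _. apply continuity_pt_filterlim, Hpsi.
    + intros t; now apply Hc.
    + intros t. apply continuity_2d_pt_const.
Qed.

Lemma is_lim_exp_times_bounded_decay (r : R -> R) m K beta :
  m < beta -> (forall s, s <= 0 -> Rabs (r s) <= K * exp (beta * s)) ->
  is_lim (fun s => exp (- m * s) * r s) m_infty 0.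
Proof.
  intros Hm Hr. apply is_lim_m_infty_eps. intros eps He.
  assert (HK : 0 <= K).
  { specialize (Hr 0 (Rle_refl 0)). rewrite Rmult_0_r, exp_0 in Hr.
    pose proof (Rabs_pos (r 0)). lra. }
  assert (Hbm : 0 < beta - m) by lra.
  assert (He' : 0 < eps / (K + 1)) by (apply Rdiv_lt_0_compat; lra).
  destruct (proj1 (is_lim_m_infty_eps _ _) (is_lim_exp_scal_m_infty (beta - m) Hbm) _ He') as [S HS].
  exists (Rmin S 0). intros s Hs.
  assert (H1 : s < S) by (apply Rlt_le_trans with (1 := Hs), Rmin_l).
  assert (H2 : s < 0) by (apply Rlt_le_trans with (1 := Hs), Rmin_r).
  specialize (HS s H1). specialize (Hr s ltac:(lra)).
  rewrite Rminus_0_r in HS |- *.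
  rewrite (Rabs_pos_eq (exp _)) in HS by (left; apply exp_pos).
  rewrite Rabs_mult, (Rabs_pos_eq (exp _)) by (left; apply exp_pos).
  replace ((beta - m) * s) with (- m * s + beta * s) in HS by ring.
  rewrite exp_plus in HS.
  apply Rle_lt_trans with (K * (exp (- m * s) * exp (beta * s))).
  - pose proof (exp_pos (- m * s)). nra.
  - apply Rmult_lt_compat_l with (r := K + 1) in HS; [|lra].
    replace ((K + 1) * (eps / (K + 1))) with eps in HS by (field; lra).
    pose proof (Rmult_lt_0_compat _ _ (exp_pos (- m * s)) (exp_pos (beta * s))). lra.
Qed.

(** * Trigonometric weights and their integrals over a period *)

Lemma continuity_mult_cos phi : continuity phi -> continuity (fun t => cos t * phi t).
Proof. intros H t. apply continuity_pt_mult; [apply continuity_cos|apply H]. Qed.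

Lemma continuity_mult_sin phi : continuity phi -> continuity (fun t => sin t * phi t).
Proof. intros H t. apply continuity_pt_mult; [apply continuity_sin|apply H]. Qed.

Lemma Rabs_cos_mult_le t x : Rabs x <= 1 -> Rabs (cos t * x) <= 1.
Proof.
  intros H. rewrite Rabs_mult.
  assert (Rabs (cos t) <= 1) by (apply Rabs_le, COS_bound).
  pose proof (Rabs_pos (cos t)). pose proof (Rabs_pos x). nra.
Qed.

Lemma Rabs_sin_mult_le t x : Rabs x <= 1 -> Rabs (sin t * x) <= 1.
Proof.
  intros H. rewrite Rabs_mult.
  assert (Rabs (sin t) <= 1) by (apply Rabs_le, SIN_bound).
  pose proof (Rabs_pos (sin t)). pose proof (Rabs_pos x). nra.
Qed.

Lemma circ_mult_cos W phi s :
  circ (fun s t => cos t * W s t) phi s = circ W (fun t => cos t * phi t) s.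
Proof. apply RInt_ext. intros; simpl; ring. Qed.

Lemma circ_mult_sin W phi s :
  circ (fun s t => sin t * W s t) phi s = circ W (fun t => sin t * phi t) s.
Proof. apply RInt_ext. intros; simpl; ring. Qed.

Lemma RInt_primitive (g G : R -> R) (l : R) :
  (forall t, is_derive G t (g t)) -> continuity g -> G (2 * PI) - G 0 = l ->
  RInt g 0 (2 * PI) = l.
Proof.
  intros HG Hg <-. apply is_RInt_unique. apply (is_RInt_derive G g); intros t _.
  - apply HG.
  - apply continuity_pt_filterlim, Hg.
Qed.

Lemma sin_sq t : sin t * sin t = 1 - cos t * cos t.
Proof. pose proof (sin2_cos2 t) as H. unfold Rsqr in H. lra. Qed.

Ltac trig_continuity :=
  repeat (apply continuity_mult || apply continuity_minus || apply continuity_plus);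
  first [apply continuity_cos | apply continuity_sin
        | apply continuity_const; intros ? ?; reflexivity].

Ltac trig_integral prim :=
  apply (RInt_primitive _ prim);
  [ let t := fresh in
    intros t; auto_derive; trivial; field [(sin_sq t)]
  | trig_continuity
  | rewrite ?cos_2PI, ?sin_2PI, ?cos_0, ?sin_0; field ].

Lemma RInt_cos : RInt cos 0 (2 * PI) = 0.
Proof. trig_integral sin. Qed.

Lemma RInt_sin : RInt sin 0 (2 * PI) = 0.
Proof. trig_integral (fun t => - cos t). Qed.

Lemma RInt_cos_cos : RInt (fun t => cos t * cos t) 0 (2 * PI) = PI.
Proof. trig_integral (fun t => t / 2 + sin t * cos t / 2). Qed.

Lemma RInt_sin_cos : RInt (fun t => sin t * cos t) 0 (2 * PI) = 0.
Proof. trig_integral (fun t => sin t * sin t / 2). Qed.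

Lemma RInt_cos_sin : RInt (fun t => cos t * sin t) 0 (2 * PI) = 0.
Proof. trig_integral (fun t => sin t * sin t / 2). Qed.

Lemma RInt_sin_sin : RInt (fun t => sin t * sin t) 0 (2 * PI) = PI.
Proof. trig_integral (fun t => t / 2 - sin t * cos t / 2). Qed.

(** [cos (2 t)] and [sin (2 t)] written as polynomials in [cos t] and [sin t], so that every
    identity below reduces to algebra modulo [sin_sq]. *)
Definition cos_double t := cos t * cos t - sin t * sin t.
Definition sin_double t := 2 * sin t * cos t.

Lemma RInt_cos2 : RInt cos_double 0 (2 * PI) = 0.
Proof. unfold cos_double. trig_integral (fun t => sin t * cos t). Qed.

Lemma RInt_sin2 : RInt sin_double 0 (2 * PI) = 0.
Proof. unfold sin_double. trig_integral (fun t => sin t * sin t). Qed.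

Lemma RInt_cc_cos2 : RInt (fun t => cos t * (cos t * cos_double t)) 0 (2 * PI) = PI / 2.
Proof.
  unfold cos_double. trig_integral (fun t => t / 4 + sin t * cos t / 2
    + sin t * cos t * (cos t * cos t - sin t * sin t) / 4).
Qed.

Lemma RInt_cs_cos2 : RInt (fun t => cos t * (sin t * cos_double t)) 0 (2 * PI) = 0.
Proof. unfold cos_double. trig_integral (fun t => sin t * cos t * (sin t * cos t) / 2). Qed.

Lemma RInt_ss_cos2 : RInt (fun t => sin t * (sin t * cos_double t)) 0 (2 * PI) = - (PI / 2).
Proof.
  unfold cos_double. trig_integral (fun t => sin t * cos t / 2 - t / 4
    - sin t * cos t * (cos t * cos t - sin t * sin t) / 4).
Qed.

Lemma RInt_cc_sin2 : RInt (fun t => cos t * (cos t * sin_double t)) 0 (2 * PI) = 0.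
Proof. unfold sin_double. trig_integral (fun t => - (cos t * cos t * (cos t * cos t)) / 2). Qed.

Lemma RInt_cs_sin2 : RInt (fun t => cos t * (sin t * sin_double t)) 0 (2 * PI) = PI / 2.
Proof.
  unfold sin_double. trig_integral (fun t => t / 4
    - sin t * cos t * (cos t * cos t - sin t * sin t) / 4).
Qed.

Lemma RInt_ss_sin2 : RInt (fun t => sin t * (sin t * sin_double t)) 0 (2 * PI) = 0.
Proof. unfold sin_double. trig_integral (fun t => sin t * sin t * (sin t * sin t) / 2). Qed.

(** * Interior estimates at the centre of a disc *)

Section CenterEstimates.

Context (D : R -> R -> Prop) (f fx fy fxx fxy fyy : R -> R -> R) (cx cy S : R)
  (HD : open2 D) (J : C2_jet D f fx fy fxx fxy fyy) (HS : 0 < S)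
  (Hc : D cx cy) (Hdisc : forall s t, s < S -> D (cx + exp s * cos t) (cy + exp s * sin t)).

(** In these coordinates the centre is at [s = -oo] and the unit circle at [s = 0]. The condition
    [0 < S] provides a slightly larger disc, so that all derivatives at [s = 0] are two-sided. *)
Let W := logpolar cx cy f.
Let Ws := lp_s cx cy fx fy.
Let Wt := lp_t cx cy fx fy.
Let Wss := lp_ss cx cy fx fy fxx fxy fyy.
Let Wst := lp_st cx cy fx fy fxx fxy fyy.
Let Wtt := lp_tt cx cy fx fy fxx fxy fyy.
Let F := logpolar cx cy (fun x y => fxx x y + fyy x y).

Lemma disc_jet : C2_jet (fun s _ => s < S) W Ws Wt Wss Wst Wtt.
Proof.
  destruct (C2_jet_logpolar cx cy D _ _ _ _ _ _ HD J) as (H1 & H2 & H3).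
  assert (H : forall s t : R, s < S -> logpolar_dom cx cy D s t)
    by (intros; now apply Hdisc).
  split; [|split].
  - now apply C1_jet_sub with (2 := H1).
  - now apply C1_jet_sub with (2 := H2).
  - now apply C1_jet_sub with (2 := H3).
Qed.

Lemma disc_continuity g gx gy s t :
  C1_jet D g gx gy -> s < S -> continuity_2d_pt (logpolar cx cy g) s t.
Proof.
  intros Hg Hs. apply continuity_2d_pt_logpolar.
  apply (C1_jet_continuity D g gx gy); trivial. now apply Hdisc.
Qed.

Lemma disc_continuity_2 s t : s < S ->
  continuity_2d_pt (logpolar cx cy fxx) s t /\
  continuity_2d_pt (logpolar cx cy fxy) s t /\
  continuity_2d_pt (logpolar cx cy fyy) s t /\ continuity_2d_pt F s t.
Proof.
  intros Hs. destruct J as (J1 & J2 & J3).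
  destruct (J2 _ _ (Hdisc s t Hs)) as (_ & _ & H1 & H2).
  destruct (J3 _ _ (Hdisc s t Hs)) as (_ & _ & _ & H3).
  split; [|split; [|split]]; apply continuity_2d_pt_logpolar; trivial.
  now apply continuity_2d_pt_plus.
Qed.

Lemma circ_lp_s psi s : continuity psi -> s < S ->
  circ Ws psi s
  = exp s * (circ (logpolar cx cy fx) (fun t => cos t * psi t) s
             + circ (logpolar cx cy fy) (fun t => sin t * psi t) s).
Proof.
  intros Hpsi Hs. destruct J as (J1 & J2 & J3).
  pose proof (fun t => disc_continuity _ _ _ s t J2 Hs) as C1.
  pose proof (fun t => disc_continuity _ _ _ s t J3 Hs) as C2.
  rewrite <- circ_mult_cos, <- circ_mult_sin, <- circ_plus; trivial.
  - rewrite <- circ_scal; trivial.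
    + apply RInt_ext. intros; unfold Ws, lp_s; simpl; ring.
    + intros t. apply continuity_2d_pt_plus; apply continuity_2d_pt_mult; trivial;
      apply continuity_2d_pt_1d_2; [apply continuity_cos|apply continuity_sin].
  - intros t. apply continuity_2d_pt_mult; trivial.
    apply continuity_2d_pt_1d_2, continuity_cos.
  - intros t. apply continuity_2d_pt_mult; trivial.
    apply continuity_2d_pt_1d_2, continuity_sin.
Qed.

(** [Ws] is [e^s] times the derivative of [f] in the direction [t]; dividing by [e^s] and shrinking
    the circle leaves the gradient at the centre. *)
Lemma circ_lp_s_lim psi : continuity psi -> (forall t, Rabs (psi t) <= 1) ->
  is_lim (fun s => exp (- 1 * s) * circ Ws psi s) m_infty
    (fx cx cy * RInt (fun t => cos t * psi t) 0 (2 * PI)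
     + fy cx cy * RInt (fun t => sin t * psi t) 0 (2 * PI)).
Proof.
  intros Hpsi Hb. destruct J as (J1 & J2 & J3).
  apply is_lim_ext_loc with (fun s =>
    circ (logpolar cx cy fx) (fun t => cos t * psi t) s
    + circ (logpolar cx cy fy) (fun t => sin t * psi t) s).
  - exists S. intros s Hs. rewrite circ_lp_s by easy.
    rewrite <- Rmult_assoc, <- exp_plus. replace (-1 * s + s) with 0 by ring.
    rewrite exp_0. ring.
  - apply is_lim_plus'.
    + apply circ_lim with S.
      * now apply (C1_jet_continuity D fx fxx fxy).
      * intros; now apply (disc_continuity _ _ _ _ _ J2).
      * now apply continuity_mult_cos.
      * intros; now apply Rabs_cos_mult_le.
    + apply circ_lim with S.
      * now apply (C1_jet_continuity D fy fxy fyy).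
      * intros; now apply (disc_continuity _ _ _ _ _ J3).
      * now apply continuity_mult_sin.
      * intros; now apply Rabs_sin_mult_le.
Qed.

(** Subtracting [Ws] from [Wss] removes the first-order remainder and leaves [e^(2 s)] times the
    Hessian form in the direction [t]; the limit reads off the Hessian at the centre. *)
Lemma circ_lp_ss_lim psi : continuity psi -> (forall t, Rabs (psi t) <= 1) ->
  is_lim (fun s => exp (- 2 * s) * (circ Wss psi s - circ Ws psi s)) m_infty
    (fxx cx cy * RInt (fun t => cos t * (cos t * psi t)) 0 (2 * PI)
     + 2 * (fxy cx cy * RInt (fun t => cos t * (sin t * psi t)) 0 (2 * PI))
     + fyy cx cy * RInt (fun t => sin t * (sin t * psi t)) 0 (2 * PI)).
Proof.
  intros Hpsi Hb. destruct J as (J1 & J2 & J3).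
  assert (Cc := continuity_mult_cos _ Hpsi). assert (Cs := continuity_mult_sin _ Hpsi).
  destruct (J2 _ _ Hc) as (_ & _ & K1 & K2).
  destruct (J3 _ _ Hc) as (_ & _ & _ & K3).
  apply is_lim_ext_loc with (fun s =>
    circ (logpolar cx cy fxx) (fun t => cos t * (cos t * psi t)) s
    + 2 * circ (logpolar cx cy fxy) (fun t => cos t * (sin t * psi t)) s
    + circ (logpolar cx cy fyy) (fun t => sin t * (sin t * psi t)) s).
  - exists S. intros s Hs.
    assert (C1 := fun t => proj1 (disc_continuity_2 s t Hs)).
    assert (C2 := fun t => proj1 (proj2 (disc_continuity_2 s t Hs))).
    assert (C3 := fun t => proj1 (proj2 (proj2 (disc_continuity_2 s t Hs)))).
    assert (HWss : forall t, continuity_2d_pt Wss s t).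
    { intros t. apply (disc_jet). exact Hs. }
    assert (HWs : forall t, continuity_2d_pt Ws s t).
    { intros t. apply (disc_jet). exact Hs. }
    unfold circ.
    rewrite <- (RInt_scal (V := R_CompleteNormedModule))
      by (apply circ_ex; [apply C2|now apply continuity_mult_cos]).
    assert (X1 := circ_ex _ _ s C1 (continuity_mult_cos _ Cc)).
    assert (X2 := circ_ex _ _ s C2 (continuity_mult_cos _ Cs)).
    assert (X3 := circ_ex _ _ s C3 (continuity_mult_sin _ Cs)).
    assert (X2' := ex_RInt_scal (V := R_NormedModule) _ _ _ 2 X2).
    rewrite <- (RInt_plus (V := R_CompleteNormedModule)) by assumption.
    rewrite <- (RInt_plus (V := R_CompleteNormedModule));
      [|now apply (ex_RInt_plus (V := R_NormedModule))|assumption].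
    rewrite <- (RInt_minus (V := R_CompleteNormedModule)) by now apply circ_ex.
    rewrite <- (RInt_scal (V := R_CompleteNormedModule)).
    + apply RInt_ext. intros t _.
      change (logpolar cx cy fxx s t * (cos t * (cos t * psi t))
        + 2 * (logpolar cx cy fxy s t * (cos t * (sin t * psi t)))
        + logpolar cx cy fyy s t * (sin t * (sin t * psi t))
        = exp (-2 * s) * (Wss s t * psi t + - (Ws s t * psi t))).
      assert (E : exp (-2 * s) * (exp s * exp s) = 1).
      { rewrite <- !exp_plus. replace (-2 * s + (s + s)) with 0 by ring. apply exp_0. }
      match goal with |- ?L = _ => transitivity
        (exp (-2 * s) * (exp s * exp s) * L);
        [rewrite E; ring|unfold Wss, lp_ss, Ws; ring] end.
    + apply (ex_RInt_minus (V := R_NormedModule)); now apply circ_ex.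
  - apply is_lim_plus'; [apply is_lim_plus'|].
    + apply circ_lim with S; trivial.
      * intros; now apply disc_continuity_2.
      * now apply continuity_mult_cos.
      * intros; now apply Rabs_cos_mult_le, Rabs_cos_mult_le.
    + apply (is_lim_scal_l _ 2 m_infty (Finite _)).
      apply circ_lim with S; trivial.
      * intros; now apply disc_continuity_2.
      * now apply continuity_mult_cos.
      * intros; now apply Rabs_cos_mult_le, Rabs_sin_mult_le.
    + apply circ_lim with S; trivial.
      * intros; now apply disc_continuity_2.
      * now apply continuity_mult_sin.
      * intros; now apply Rabs_sin_mult_le, Rabs_sin_mult_le.
Qed.

Section Mode.

Context (phi phi1 : R -> R) (m : R) (Hm : 0 <= m)
  (Hphi : forall t, is_derive phi t (phi1 t))
  (Hphi1 : forall t, is_derive phi1 t (- m ^ 2 * phi t))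
  (Ephi : phi (2 * PI) = phi 0) (Ephi1 : phi1 (2 * PI) = phi1 0)
  (Bphi : forall t, Rabs (phi t) <= 1) (Iphi : m * RInt phi 0 (2 * PI) = 0).

Lemma mode_continuity : continuity phi.
Proof. intros t. now apply continuity_pt_is_derive with (phi1 t). Qed.

Lemma circ_mode_derive s : s < S ->
  is_derive (circ W phi) s (circ Ws phi s) /\
  is_derive (circ Ws phi) s (circ Wss phi s).
Proof.
  intros Hs. destruct disc_jet as (H1 & H2 & _). split.
  - now apply (circ_derive S W Ws Wt); [|apply mode_continuity|].
  - now apply (circ_derive S Ws Wss Wst); [|apply mode_continuity|].
Qed.

(** The equation [Wss + Wtt = e^(2 s) F] tested against [phi], which is an eigenfunction of the
    second derivative in [t]. *)
Lemma circ_mode_ode s : s < S ->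
  circ Wss phi s - m ^ 2 * circ W phi s = exp (2 * s) * circ F phi s.
Proof.
  intros Hs. destruct disc_jet as (H1 & H2 & H3).
  assert (Hphic := mode_continuity).
  assert (E : circ Wtt phi s = - m ^ 2 * circ W phi s).
  { apply (circ_by_parts W Wt Wtt phi phi1); trivial.
    - intros t; now apply H1.
    - intros t; now apply H3.
    - intros t. apply (C1_jet_continuity (fun s _ => s < S) W Ws Wt); trivial.
      apply open2_half_plane.
    - intros t; now apply H3.
    - unfold W, logpolar. now rewrite cos_2PI, sin_2PI, cos_0, sin_0.
    - unfold Wt, lp_t, logpolar. now rewrite cos_2PI, sin_2PI, cos_0, sin_0. }
  assert (E2 : circ Wss phi s + circ Wtt phi s = exp (2 * s) * circ F phi s).
  { rewrite <- circ_plus; trivial.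
    - rewrite <- (circ_scal (fun s => exp (2 * s))); trivial.
      + apply RInt_ext. intros t _. f_equal. apply lp_laplacian.
      + intros t. now apply disc_continuity_2.
    - intros t; now apply H2.
    - intros t; now apply H3. }
  rewrite E in E2. lra.
Qed.

(** The coefficient of [Ws] is [O(e^s)], and that of [W] tends to the value at the centre times the
    integral of [phi]. [Iphi] kills the latter in both cases at once: either [m = 0], or [phi] has
    mean zero. *)
Lemma circ_mode_lim_first_order :
  is_lim (fun s => circ Ws phi s - m * circ W phi s) m_infty 0.
Proof.
  destruct J as (J1 & J2 & J3). assert (Hphic := mode_continuity).
  replace 0 with (0 * (fx cx cy * RInt (fun t => cos t * phi t) 0 (2 * PI)
     + fy cx cy * RInt (fun t => sin t * phi t) 0 (2 * PI))
     - m * (f cx cy * RInt phi 0 (2 * PI))).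
  - apply is_lim_minus'.
    + apply is_lim_ext with (fun s => exp (1 * s) * (exp (-1 * s) * circ Ws phi s)).
      * intros s. rewrite <- Rmult_assoc, <- exp_plus.
        replace (1 * s + -1 * s) with 0 by ring. rewrite exp_0. ring.
      * apply (is_lim_mult _ _ _ 0 (Finite _)); try easy.
        -- apply is_lim_exp_scal_m_infty. lra.
        -- now apply circ_lp_s_lim.
    + apply (is_lim_scal_l _ m m_infty (Finite _)).
      apply circ_lim with S; trivial.
      * now apply (C1_jet_continuity D f fx fy).
      * intros; now apply (disc_continuity _ _ _ _ _ J1).
  - rewrite Rmult_0_l. replace (m * (f cx cy * RInt phi 0 (2 * PI)))
      with (f cx cy * (m * RInt phi 0 (2 * PI))) by ring. rewrite Iphi. ring.
Qed.

Context (K beta : R) (Hbeta : m < beta)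
  (HK : forall s, s <= 0 -> Rabs (exp (2 * s) * circ F phi s) <= K * exp (beta * s)).

Lemma circ_mode_estimate b0 :
  is_lim (fun s => exp (- m * s) * circ W phi s) m_infty (Finite b0) ->
  Rabs (circ W phi 0 - b0) <= K / (m + beta) / (beta - m).
Proof.
  intros Hb. apply (mode_estimate _ (circ Ws phi) (circ Wss phi)); trivial.
  - lra.
  - intros s Hs. exact (proj1 (circ_mode_derive s ltac:(lra))).
  - intros s Hs. exact (proj2 (circ_mode_derive s ltac:(lra))).
  - intros s Hs. rewrite circ_mode_ode by lra. now apply HK.
  - apply circ_mode_lim_first_order.
Qed.

Lemma circ_mode_first_order :
  forall s, s <= 0 ->
  Rabs (circ Ws phi s - m * circ W phi s) <= K / (m + beta) * exp (beta * s).
Proof.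
  apply (mode_first_order _ (circ Ws phi) (circ Wss phi)); trivial.
  - lra.
  - intros s Hs. exact (proj1 (circ_mode_derive s ltac:(lra))).
  - intros s Hs. exact (proj2 (circ_mode_derive s ltac:(lra))).
  - intros s Hs. rewrite circ_mode_ode by lra. now apply HK.
  - apply circ_mode_lim_first_order.
Qed.

End Mode.

(** A bounded Laplacian gives the forcing exponent [beta = 2], which exceeds [m] for the modes 0 and
    1 only. *)
Lemma circ_laplacian_bound phi E s :
  continuity phi -> (forall t, Rabs (phi t) <= 1) ->
  (forall s t, s <= 0 -> Rabs (F s t) <= E) -> s <= 0 ->
  Rabs (exp (2 * s) * circ F phi s) <= 2 * PI * E * exp (2 * s).
Proof.
  intros Hphi Hb HE Hs.
  rewrite Rabs_mult, (Rabs_pos_eq (exp _)) by (left; apply exp_pos).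
  rewrite Rmult_comm. apply Rmult_le_compat_r; [left; apply exp_pos|].
  apply circ_bound; trivial.
  - intros t. apply disc_continuity_2. lra.
  - intros t. now apply HE.
Qed.

(** Mode [m = 0] with [beta = 2]: a quantitative mean value property. *)
Lemma mean_value_estimate E :
  (forall s t, s <= 0 -> Rabs (F s t) <= E) ->
  Rabs (circ W (fun _ => 1) 0 - 2 * PI * f cx cy) <= PI * E / 2.
Proof.
  intros HE.
  assert (C1 : continuity (fun _ => 1)) by (apply continuity_const; intros ? ?; reflexivity).
  assert (B1 : R -> Rabs 1 <= 1) by (intros _; rewrite Rabs_R1; lra).
  replace (PI * E / 2) with (2 * PI * E / (0 + 2) / (2 - 0)) by field.
  apply (circ_mode_estimate (fun _ => 1) (fun _ => 0) 0); trivial; try lra.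
  - intros t. apply (is_derive_const (K := R_AbsRing) (V := R_NormedModule)).
  - intros t. evar_last. apply (is_derive_const (K := R_AbsRing) (V := R_NormedModule)).
    unfold zero; simpl; ring.
  - intros s Hs. now apply circ_laplacian_bound.
  - destruct J as (J1 & _).
    apply is_lim_ext with (circ W (fun _ => 1)).
    { intros s. rewrite Ropp_0, Rmult_0_l, exp_0. ring. }
    replace (2 * PI * f cx cy) with (f cx cy * RInt (fun _ => 1) 0 (2 * PI)).
    + apply circ_lim with S; trivial.
      * now apply (C1_jet_continuity D f fx fy).
      * intros; now apply (disc_continuity _ _ _ _ _ J1).
    + rewrite RInt_const. unfold scal; simpl; unfold mult; simpl. ring.
Qed.

(** Mode [m = 1] with [beta = 2]. The coefficient [b0] comes from [a = a' - (a' - a)]: after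
    multiplication by [e^(- s)] the first term tends to a combination of [fx] and [fy] at the
    centre, and the second, being [O(e^(2 s))] beforehand, tends to 0. *)
Lemma first_mode_estimate (phi phi1 : R -> R) E :
  (forall t, is_derive phi t (phi1 t)) ->
  (forall t, is_derive phi1 t (- phi t)) ->
  phi (2 * PI) = phi 0 -> phi1 (2 * PI) = phi1 0 ->
  (forall t, Rabs (phi t) <= 1) -> RInt phi 0 (2 * PI) = 0 ->
  (forall s t, s <= 0 -> Rabs (F s t) <= E) ->
  Rabs (circ W phi 0
        - (fx cx cy * RInt (fun t => cos t * phi t) 0 (2 * PI)
           + fy cx cy * RInt (fun t => sin t * phi t) 0 (2 * PI))) <= 2 * PI * E / 3.
Proof.
  intros Hphi Hphi1 E1 E2 Hb I0 HE.
  assert (Cphi := mode_continuity phi phi1 Hphi).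
  assert (Hphi1' : forall t, is_derive phi1 t (- 1 ^ 2 * phi t)).
  { intros t. replace (- 1 ^ 2 * phi t) with (- phi t) by ring. apply Hphi1. }
  assert (HK : forall s, s <= 0 ->
    Rabs (exp (2 * s) * circ F phi s) <= 2 * PI * E * exp (2 * s)).
  { intros; now apply circ_laplacian_bound. }
  assert (I1 : 1 * RInt phi 0 (2 * PI) = 0) by (rewrite I0; ring).
  replace (2 * PI * E / 3) with (2 * PI * E / (1 + 2) / (2 - 1)) by field.
  apply (circ_mode_estimate phi phi1 1); trivial; try lra.
  assert (Hr := circ_mode_first_order phi phi1 1 Rle_0_1 Hphi Hphi1' E1 E2 Hb I1
    (2 * PI * E) 2 ltac:(lra) HK).
  apply is_lim_ext with (fun s => exp (-1 * s) * circ Ws phi s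
    - exp (-1 * s) * (circ Ws phi s - 1 * circ W phi s)).
  { intros s. replace (Ropp 1) with (-1) by lra. ring. }
  match goal with |- is_lim _ _ (Finite ?l) => replace l with (l - 0) by ring end.
  apply is_lim_minus'.
  - now apply circ_lp_s_lim.
  - apply (is_lim_exp_times_bounded_decay
      (fun s => circ Ws phi s - 1 * circ W phi s) 1 (2 * PI * E / (1 + 2)) 2);
      [lra|exact Hr].
Qed.

(** Mode [m = 2], where [beta = 2] would be resonant. A Holder condition on the Laplacian at the
    centre raises the exponent to [beta = 2 + gamma], at the price of a factor [1 / gamma]. *)
Lemma second_mode_estimate (phi phi1 : R -> R) K gamma :
  0 < gamma ->
  (forall t, is_derive phi t (phi1 t)) ->
  (forall t, is_derive phi1 t (- 4 * phi t)) ->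
  phi (2 * PI) = phi 0 -> phi1 (2 * PI) = phi1 0 ->
  (forall t, Rabs (phi t) <= 1) -> RInt phi 0 (2 * PI) = 0 ->
  (forall s t, s <= 0 ->
     Rabs (F s t - (fxx cx cy + fyy cx cy)) <= K * exp (gamma * s)) ->
  Rabs (circ W phi 0
        - (fxx cx cy * RInt (fun t => cos t * (cos t * phi t)) 0 (2 * PI)
           + 2 * (fxy cx cy * RInt (fun t => cos t * (sin t * phi t)) 0 (2 * PI))
           + fyy cx cy * RInt (fun t => sin t * (sin t * phi t)) 0 (2 * PI)) / 2)
  <= 2 * PI * K / (4 + gamma) / gamma.
Proof.
  intros Hg Hphi Hphi1 E1 E2 Hb I0 HE.
  assert (Cphi := mode_continuity phi phi1 Hphi).
  assert (Hphi1' : forall t, is_derive phi1 t (- 2 ^ 2 * phi t)).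
  { intros t. replace (- 2 ^ 2 * phi t) with (- 4 * phi t) by ring. apply Hphi1. }
  (* The value of the Laplacian at the centre is a constant, hence orthogonal to [phi] by [I0]; only
     the deviation from it forces this mode. *)
  assert (HK : forall s, s <= 0 ->
    Rabs (exp (2 * s) * circ F phi s) <= 2 * PI * K * exp ((2 + gamma) * s)).
  { intros s Hs.
    replace (circ F phi s) with
      (circ (fun s t => F s t + - (fxx cx cy + fyy cx cy)) phi s).
    - rewrite Rabs_mult, (Rabs_pos_eq (exp _)) by (left; apply exp_pos).
      replace ((2 + gamma) * s) with (2 * s + gamma * s) by ring. rewrite exp_plus.
      replace (2 * PI * K * (exp (2 * s) * exp (gamma * s)))
        with (exp (2 * s) * (2 * PI * (K * exp (gamma * s)))) by ring.
      apply Rmult_le_compat_l; [left; apply exp_pos|].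
      apply circ_bound; trivial.
      + intros t. apply continuity_2d_pt_plus; [|apply continuity_2d_pt_const].
        apply disc_continuity_2. lra.
      + intros t. now apply HE.
    - rewrite circ_plus; trivial.
      + replace (circ (fun _ _ => - (fxx cx cy + fyy cx cy)) phi s)
          with (- (fxx cx cy + fyy cx cy) * RInt phi 0 (2 * PI)).
        * rewrite I0. ring.
        * symmetry. unfold circ. apply (RInt_scal (V := R_CompleteNormedModule) phi).
          apply (ex_RInt_continuous (V := R_CompleteNormedModule)).
          intros t _. apply continuity_pt_filterlim, Cphi.
      + intros t. apply disc_continuity_2. lra.
      + intros t. apply continuity_2d_pt_const. }
  assert (I1 : 2 * RInt phi 0 (2 * PI) = 0) by (rewrite I0; ring).
  replace (2 * PI * K / (4 + gamma) / gamma)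
    with (2 * PI * K / (2 + (2 + gamma)) / (2 + gamma - 2)) by (field; lra).
  apply (circ_mode_estimate phi phi1 2); trivial; try lra.
  assert (Hr := circ_mode_first_order phi phi1 2 ltac:(lra) Hphi Hphi1' E1 E2 Hb I1
    (2 * PI * K) (2 + gamma) ltac:(lra) HK).
  (* [2 a = (a'' - a') - (a'' - 4 a) + (a' - 2 a)] *)
  apply is_lim_ext_loc with (fun s =>
    (exp (-2 * s) * (circ Wss phi s - circ Ws phi s)
     - (exp (-2 * s) * (circ Wss phi s - 2 ^ 2 * circ W phi s)
        - exp (-2 * s) * (circ Ws phi s - 2 * circ W phi s))) / 2).
  { exists S. intros s _. replace (- (2)) with (-2) by lra. field. }
  match goal with |- is_lim _ _ (Finite (?l / 2)) =>
    replace (l / 2) with ((l - (0 - 0)) / 2) by field end.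
  apply (is_lim_scal_r _ (/ 2) m_infty (Finite _)).
  apply is_lim_minus'; [|apply is_lim_minus'].
  - now apply circ_lp_ss_lim.
  - apply (is_lim_exp_times_bounded_decay
      (fun s => circ Wss phi s - 2 ^ 2 * circ W phi s) 2 (2 * PI * K) (2 + gamma)); [lra|].
    intros s Hs. rewrite (circ_mode_ode phi phi1 2); trivial; [|lra]. now apply HK.
  - apply (is_lim_exp_times_bounded_decay
      (fun s => circ Ws phi s - 2 * circ W phi s) 2
      (2 * PI * K / (2 + (2 + gamma))) (2 + gamma)); [lra|exact Hr].
Qed.


Lemma cos_double_mode :
  (forall t, is_derive cos_double t (- 2 * sin_double t)) /\
  (forall t, is_derive (fun t => - 2 * sin_double t) t (- 4 * cos_double t)) /\
  (forall t, Rabs (cos_double t) <= 1).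
Proof.
  unfold cos_double, sin_double. split; [|split].
  - intros t. auto_derive; trivial; ring.
  - intros t. auto_derive; trivial; ring.
  - intros t. pose proof (sin_sq t). pose proof (Rle_0_sqr (sin t)).
    pose proof (Rle_0_sqr (cos t)). unfold Rsqr in *. apply Rabs_le; lra.
Qed.

Lemma sin_double_mode :
  (forall t, is_derive sin_double t (2 * cos_double t)) /\
  (forall t, is_derive (fun t => 2 * cos_double t) t (- 4 * sin_double t)) /\
  (forall t, Rabs (sin_double t) <= 1).
Proof.
  unfold cos_double, sin_double. split; [|split].
  - intros t. auto_derive; trivial; ring.
  - intros t. auto_derive; trivial; ring.
  - intros t. pose proof (sin_sq t). pose proof (Rle_0_sqr (sin t + cos t)).
    pose proof (Rle_0_sqr (sin t - cos t)). unfold Rsqr in *. apply Rabs_le; lra.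
Qed.

Lemma W_continuity s t : s < S -> continuity_2d_pt W s t.
Proof. intros Hs. now apply (disc_continuity _ fx fy); [apply J|]. Qed.

(** Differential Harnack inequality. For a nonnegative function the first Fourier coefficient is at
    most the zeroth, which the mean value estimate ties to the value at the centre. The errors add
    up to [E (1/2 + 2/3)] after division by [PI], within [2 E]. Only the [y]-derivative is
    estimated, since it will be integrated along a circle about the singularity. *)
Lemma gradient_estimate_nonneg E :
  (forall t, 0 <= W 0 t) -> (forall s t, s <= 0 -> Rabs (F s t) <= E) ->
  Rabs (fy cx cy) <= 2 * f cx cy + 2 * E.
Proof.
  intros Hpos HE. pose proof PI_RGT_0 as Hpi.
  assert (HE0 : 0 <= E).
  { apply Rle_trans with (2 := HE 0 0 (Rle_refl 0)). apply Rabs_pos. }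
  pose proof (mean_value_estimate E HE) as H0.
  pose proof (first_mode_estimate sin cos E) as H1.
  rewrite RInt_cos_sin, RInt_sin_sin in H1.
  specialize (H1 is_derive_sin is_derive_cos).
  rewrite cos_2PI, sin_2PI, cos_0, sin_0 in H1.
  specialize (H1 eq_refl eq_refl (fun t => Rabs_le _ _ (SIN_bound t)) RInt_sin HE).
  assert (C := fun t => W_continuity 0 t HS).
  assert (C1 : continuity (fun _ => 1)) by (apply continuity_const; intros ? ?; reflexivity).
  assert (H2 : Rabs (circ W sin 0) <= circ W (fun _ => 1) 0).
  { assert (X1 := circ_ex W (fun _ => 1) 0 C C1).
    assert (X2 := circ_ex W sin 0 C continuity_sin).
    assert (Hle : 0 <= 2 * PI) by (left; apply two_PI_pos).
    apply Rabs_le. split.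
    - unfold circ. rewrite <- (RInt_opp (V := R_CompleteNormedModule)) by assumption.
      apply RInt_le; trivial.
      + now apply (ex_RInt_opp (V := R_NormedModule)).
      + intros t _. change (- (W 0 t * 1) <= W 0 t * sin t).
        specialize (Hpos t). pose proof (SIN_bound t). nra.
    - apply RInt_le; trivial.
      intros t _. specialize (Hpos t). pose proof (SIN_bound t). nra. }
  apply Rabs_le_between in H0. apply Rabs_le_between in H1. apply Rabs_le_between in H2.
  assert (H : Rabs (PI * fy cx cy) <= PI * (2 * f cx cy + 2 * E)).
  { apply Rabs_le. split; nra. }
  rewrite Rabs_mult, (Rabs_pos_eq PI) in H by lra.
  now apply Rmult_le_reg_l with PI.
Qed.

(** The modes [cos] and [sin] isolate [PI fx] and [PI fy]. Each coefficient is at most [2 PI eps] on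
    the unit circle, with error [2 PI eps / 3]. *)
Lemma gradient_estimate eps :
  (forall t, Rabs (W 0 t) <= eps) -> (forall s t, s <= 0 -> Rabs (F s t) <= eps) ->
  Rabs (fx cx cy) <= 4 * eps /\ Rabs (fy cx cy) <= 4 * eps.
Proof.
  intros HW HE. pose proof PI_RGT_0 as Hpi.
  assert (Heps : 0 <= eps).
  { apply Rle_trans with (2 := HW 0). apply Rabs_pos. }
  assert (C := fun t => W_continuity 0 t HS).
  assert (Bs : forall t, Rabs (sin t) <= 1) by (intros; apply Rabs_le, SIN_bound).
  assert (Bc : forall t, Rabs (cos t) <= 1) by (intros; apply Rabs_le, COS_bound).
  pose proof (first_mode_estimate sin cos eps is_derive_sin is_derive_cos) as H1.
  rewrite RInt_cos_sin, RInt_sin_sin in H1.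
  pose proof (first_mode_estimate cos (fun t => - sin t) eps is_derive_cos) as H2.
  rewrite RInt_cos_cos, RInt_sin_cos in H2.
  rewrite cos_2PI, sin_2PI, cos_0, sin_0 in H1, H2.
  specialize (H1 eq_refl eq_refl Bs RInt_sin HE).
  specialize (H2 (fun t => is_derive_opp _ _ _ (is_derive_sin t))
    eq_refl eq_refl Bc RInt_cos HE).
  pose proof (circ_bound W sin 0 eps C continuity_sin Bs HW) as K1.
  pose proof (circ_bound W cos 0 eps C continuity_cos Bc HW) as K2.
  apply Rabs_le_between in H1. apply Rabs_le_between in H2.
  apply Rabs_le_between in K1. apply Rabs_le_between in K2.
  split; apply Rmult_le_reg_l with PI; try lra;
  rewrite <- (Rabs_pos_eq PI) at 1 by lra; rewrite <- Rabs_mult;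
  apply Rabs_le; split; nra.
Qed.

(** The modes [cos (2 t)] and [sin (2 t)] isolate [PI / 4 (fxx - fyy)] and [PI / 2 fxy]; the factor
    8 is [2 PI] divided by [PI / 4]. The trace is invisible to these modes and has to come from the
    equation. *)
Lemma hessian_estimate eps gamma :
  0 < gamma -> (forall t, Rabs (W 0 t) <= eps) ->
  (forall s t, s <= 0 ->
     Rabs (F s t - (fxx cx cy + fyy cx cy)) <= eps * exp (gamma * s)) ->
  Rabs (fxx cx cy - fyy cx cy) <= 8 * eps * (1 + / gamma) /\
  Rabs (fxy cx cy) <= 8 * eps * (1 + / gamma).
Proof.
  intros Hg HW HE. pose proof PI_RGT_0 as Hpi.
  assert (Heps : 0 <= eps).
  { apply Rle_trans with (2 := HW 0). apply Rabs_pos. }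
  assert (C := fun t => W_continuity 0 t HS).
  destruct cos_double_mode as (D1 & D2 & B1). destruct sin_double_mode as (D3 & D4 & B2).
  pose proof (second_mode_estimate cos_double (fun t => - 2 * sin_double t) eps gamma Hg D1 D2) as H1.
  rewrite RInt_cc_cos2, RInt_cs_cos2, RInt_ss_cos2 in H1.
  pose proof (second_mode_estimate sin_double (fun t => 2 * cos_double t) eps gamma Hg D3 D4) as H2.
  rewrite RInt_cc_sin2, RInt_cs_sin2, RInt_ss_sin2 in H2.
  specialize (H1 ltac:(unfold cos_double; now rewrite cos_2PI, sin_2PI, cos_0, sin_0)
    ltac:(unfold sin_double; now rewrite cos_2PI, sin_2PI, cos_0, sin_0) B1 RInt_cos2 HE).
  specialize (H2 ltac:(unfold sin_double; now rewrite cos_2PI, sin_2PI, cos_0, sin_0)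
    ltac:(unfold cos_double; now rewrite cos_2PI, sin_2PI, cos_0, sin_0) B2 RInt_sin2 HE).
  pose proof (circ_bound W cos_double 0 eps C (mode_continuity _ _ D1) B1 HW) as K1.
  pose proof (circ_bound W sin_double 0 eps C (mode_continuity _ _ D3) B2 HW) as K2.
  assert (Hq : 2 * PI * eps / (4 + gamma) / gamma <= 2 * PI * eps * / gamma).
  { apply Rmult_le_compat_r; [left; now apply Rinv_0_lt_compat|].
    assert (0 <= 2 * PI * eps) by (apply Rmult_le_pos; lra).
    rewrite <- (Rmult_1_r (2 * PI * eps)) at 2. apply Rmult_le_compat_l; trivial.
    rewrite <- Rinv_1. apply Rinv_le_contravar; lra. }
  assert (Hi : 0 <= PI * eps * / gamma).
  { apply Rmult_le_pos; [apply Rmult_le_pos; lra|]. left; now apply Rinv_0_lt_compat. }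
  assert (Hpe : 0 <= PI * eps) by (apply Rmult_le_pos; lra).
  apply Rabs_le_between in H1. apply Rabs_le_between in H2.
  apply Rabs_le_between in K1. apply Rabs_le_between in K2.
  split; apply Rmult_le_reg_l with PI; try lra;
  rewrite <- (Rabs_pos_eq PI) at 1 by lra; rewrite <- Rabs_mult;
  replace (PI * (8 * eps * (1 + / gamma))) with (8 * (PI * eps) + 8 * (PI * eps * / gamma)) by ring;
  apply Rabs_le; split; lra.
Qed.

End CenterEstimates.

(** * Comparison principle on a periodic strip *)

(** If [d > 0], then [f1], which vanishes at [x], is positive just to the right of [x], and [f]
    rises above its maximum. *)
Lemma second_derivative_at_max (f f1 : R -> R) x d delta :
  0 < delta ->
  (forall y, Rabs (y - x) < delta -> is_derive f y (f1 y)) ->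
  is_derive f1 x d -> (forall y, Rabs (y - x) < delta -> f y <= f x) -> d <= 0.
Proof.
  intros Hdelta Hf Hf1 Hmax.
  destruct (Rle_or_lt d 0) as [|Hd]; [easy|exfalso].
  assert (Hin : forall y, x - delta < y < x + delta -> Rabs (y - x) < delta).
  { intros y Hy. apply Rabs_def1; lra. }
  assert (Ex : f1 x = 0).
  { assert (pr : derivable_pt_lim f x (f1 x)) by (apply is_derive_Reals, Hf, Hin; lra).
    rewrite <- (derive_pt_eq_0 f x (f1 x) (exist _ _ pr) pr).
    apply (deriv_maximum f (x - delta) (x + delta)); try lra.
    intros y H1 H2. apply Hmax, Hin; lra. }
  apply is_derive_Reals in Hf1.
  destruct (Hf1 d Hd) as [eta Heta].
  assert (Hpos : forall y, x < y < x + eta -> 0 < f1 y).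
  { intros y Hy. specialize (Heta (y - x) ltac:(lra) ltac:(apply Rabs_def1; lra)).
    replace (x + (y - x)) with y in Heta by ring. rewrite Ex in Heta.
    apply Rabs_lt_between in Heta. destruct Heta as [Heta _].
    assert (Hq : 0 < (f1 y - 0) / (y - x)) by lra.
    apply Rmult_lt_compat_r with (r := y - x) in Hq; [|lra].
    replace ((f1 y - 0) / (y - x) * (y - x)) with (f1 y) in Hq by (field; lra). lra. }
  pose proof (cond_pos eta) as He.
  set (e := Rmin delta eta / 4).
  assert (0 < e /\ 4 * e <= delta /\ 4 * e <= eta) as (He1 & He2 & He3).
  { unfold e. pose proof (Rmin_l delta eta). pose proof (Rmin_r delta eta).
    assert (0 < Rmin delta eta) by (apply Rmin_pos; lra). lra. }
  (* The mean value theorem places its point in the closed interval, and [f1 x = 0]. Weak growth is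
     therefore taken on [[x, x + e]] and strict growth on [[x + e, x + 2 e]]. *)
  assert (Hmono : f x <= f (x + e)).
  { apply (nondecreasing_of_derive_nonneg f f1); [lra| |].
    - intros y Hy. apply Hf, Hin; lra.
    - intros y Hy. destruct (Req_dec y x) as [->|Hyx]; [lra|].
      left; apply Hpos; lra. }
  destruct (MVT_gen f (x + e) (x + 2 * e) f1) as (c & Hc & Ec).
  - rewrite Rmin_left, Rmax_right by lra. intros y Hy. apply Hf, Hin; lra.
  - rewrite Rmin_left, Rmax_right by lra. intros y Hy.
    apply continuity_pt_is_derive with (f1 y), Hf, Hin; lra.
  - rewrite Rmin_left, Rmax_right in Hc by lra.
    assert (0 < f1 c) by (apply Hpos; lra).
    assert (f (x + 2 * e) <= f x) by (apply Hmax, Hin; lra).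
    assert (0 < f1 c * (x + 2 * e - (x + e))) by (apply Rmult_lt_0_compat; lra). lra.
Qed.

(** The extreme value theorem is iterated: maximize in [y], check by uniform continuity that the
    maximum depends continuously on [x], then maximize in [x]. *)
Lemma rectangle_max (f : R -> R -> R) a b c d :
  a <= b -> c <= d ->
  (forall x y, a <= x <= b -> c <= y <= d -> continuity_2d_pt f x y) ->
  exists x0 y0, a <= x0 <= b /\ c <= y0 <= d /\
    forall x y, a <= x <= b -> c <= y <= d -> f x y <= f x0 y0.
Proof.
  intros Hab Hcd Hf.
  (* Clamping [x] to [[a, b]] makes the partial maximum continuous on the whole line, as the
     one-variable theorem asks for two-sided continuity at the end points. *)
  set (cl := fun x => Rmax a (Rmin b x)).
  assert (Hcl : forall x, a <= cl x <= b).
  { intros x. unfold cl. split; [apply Rmax_l|].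
    apply Rmax_lub; [easy|apply Rmin_l]. }
  assert (Ecl : forall x, a <= x <= b -> cl x = x).
  { intros x Hx. unfold cl. rewrite Rmin_right, Rmax_right; lra. }
  assert (Lcl : forall x x', Rabs (cl x - cl x') <= Rabs (x - x')).
  { intros x x'. unfold cl, Rmax, Rmin.
    repeat destruct Rle_dec; unfold Rabs; repeat destruct Rcase_abs; lra. }
  assert (Hy : forall x, exists y, c <= y <= d /\
    forall y', c <= y' <= d -> f (cl x) y' <= f (cl x) y).
  { intros x. destruct (continuity_ab_maj (f (cl x)) c d Hcd) as (y & Hy & Hy').
    - intros y Hy. apply continuity_2d_pt_slice. now apply Hf.
    - exists y. now split. }
  (* Defined as a supremum, the maximum is a function of [x] without a choice of maximizers. *)
  set (m := fun x => real (Lub_Rbar (fun v => exists y, c <= y <= d /\ v = f (cl x) y))).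
  assert (Hm : forall x y, c <= y <= d ->
    (forall y', c <= y' <= d -> f (cl x) y' <= f (cl x) y) -> m x = f (cl x) y).
  { intros x y Hyc Hymax. unfold m.
    rewrite (is_lub_Rbar_unique _ (Finite (f (cl x) y))); [easy|]. split.
    - intros v (y' & Hy' & ->). now apply Hymax.
    - intros l Hl. apply Hl. now exists y. }
  assert (Cm : forall x, continuity_pt m x).
  { intros x. apply continuity_pt_locally. intros eps.
    destruct (uniform_continuity_2d f a b c d Hf eps) as [delta Hdelta].
    exists delta. intros x' Hx'. change (Rabs (x' - x) < delta) in Hx'.
    destruct (Hy x) as (y & Hy1 & Hy2). destruct (Hy x') as (y' & Hy1' & Hy2').
    rewrite (Hm x y), (Hm x' y') by easy.
    assert (Hd0 : forall z, Rabs (z - z) < delta).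
    { intros z. rewrite Rminus_diag, Rabs_R0. apply cond_pos. }
    assert (Hcx : Rabs (cl x' - cl x) < delta) by (eapply Rle_lt_trans; eauto).
    pose proof (Hdelta (cl x) y (cl x') y (Hcl x) Hy1 (Hcl x') Hy1 Hcx (Hd0 y)) as K1.
    pose proof (Hdelta (cl x) y' (cl x') y' (Hcl x) Hy1' (Hcl x') Hy1' Hcx (Hd0 y')) as K2.
    specialize (Hy2 y' Hy1'). specialize (Hy2' y Hy1).
    apply Rabs_lt_between in K1. apply Rabs_lt_between in K2.
    apply Rabs_def1; lra. }
  destruct (continuity_ab_maj m a b Hab) as (x0 & Hx0 & Hx0').
  { intros x _. apply Cm. }
  destruct (Hy x0) as (y0 & Hy0 & Hy0'). exists x0, y0.
  split; [easy|split; [easy|]]. intros x y Hx Hyc.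
  destruct (Hy x) as (y1 & Hy1 & Hy1').
  specialize (Hx0 x Hx). rewrite (Hm x y1), (Hm x0 y0) in Hx0 by easy.
  rewrite !Ecl in * by easy. specialize (Hy1' y Hyc). lra.
Qed.

(** Periodicity in the form that compactness uses: each [t] is replaced by a [t'] of one period, the
    same for all [s]. *)
Definition periodic2 (U : R -> R -> R) : Prop :=
  forall t, exists t', 0 <= t' <= 2 * PI /\ forall s, U s t = U s t'.

(** Periodicity makes the strip compact, so [U - h] attains its maximum. If that is positive it lies
    off both boundary circles, and both second derivatives of [U - h] are nonpositive there, against
    the strict inequality of the Laplacians. That inequality is demanded only where [h < U], which
    is what the exponential nonlinearity can provide. *)
Lemma periodic_strip_comparison U Us Ut Uss Ust Utt (h h1 h2 : R -> R) S s1 s2 :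
  C2_jet (fun s _ => s < S) U Us Ut Uss Ust Utt -> periodic2 U ->
  s1 <= s2 < S ->
  (forall s, s1 <= s <= s2 -> is_derive h s (h1 s)) ->
  (forall s, s1 <= s <= s2 -> is_derive h1 s (h2 s)) ->
  (forall t, U s1 t <= h s1) -> (forall t, U s2 t <= h s2) ->
  (forall s t, s1 < s < s2 -> h s < U s t -> h2 s < Uss s t + Utt s t) ->
  forall s t, s1 <= s <= s2 -> U s t <= h s.
Proof.
  intros (J1 & J2 & J3) Hper Hs Hh Hh1 B1 B2 Hint s t Hst.
  pose proof two_PI_pos as Hpi.
  destruct (rectangle_max (fun s t => U s t - h s) s1 s2 0 (2 * PI))
    as (s0 & t0 & Hs0 & Ht0 & Hmax); try lra.
  { intros x y Hx _. apply continuity_2d_pt_minus.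
    - apply (C1_jet_continuity (fun s _ => s < S) U Us Ut); trivial; [|lra].
      apply open2_half_plane.
    - apply continuity_2d_pt_1d_1, continuity_pt_is_derive with (h1 x). now apply Hh. }
  assert (Hmax' : forall s t, s1 <= s <= s2 -> U s t - h s <= U s0 t0 - h s0).
  { intros x y Hx. destruct (Hper y) as (y' & Hy' & E). rewrite E. now apply Hmax. }
  destruct (Rle_or_lt (U s0 t0) (h s0)) as [Hle|Hlt].
  { specialize (Hmax' s t Hst). lra. }
  exfalso.
  assert (Hi : s1 < s0 < s2).
  { destruct (Req_dec s0 s1) as [->|]; [specialize (B1 t0); lra|].
    destruct (Req_dec s0 s2) as [->|]; [specialize (B2 t0); lra|]. lra. }
  specialize (Hint s0 t0 Hi Hlt).
  assert (K1 : Uss s0 t0 - h2 s0 <= 0).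
  { apply (second_derivative_at_max (fun s => U s t0 - h s) (fun s => Us s t0 - h1 s)
      s0 _ (Rmin (s0 - s1) (s2 - s0))).
    - apply Rmin_pos; lra.
    - intros y Hy. assert (s1 <= y <= s2).
      { pose proof (Rmin_l (s0 - s1) (s2 - s0)). pose proof (Rmin_r (s0 - s1) (s2 - s0)).
        apply Rabs_lt_between in Hy. lra. }
      apply (is_derive_minus (fun s => U s t0) h); [apply J1; lra|now apply Hh].
    - apply (is_derive_minus (fun s => Us s t0) h1); [apply J2; lra|apply Hh1; lra].
    - intros y Hy. apply Hmax'.
      pose proof (Rmin_l (s0 - s1) (s2 - s0)). pose proof (Rmin_r (s0 - s1) (s2 - s0)).
      apply Rabs_lt_between in Hy. lra. }
  assert (K2 : Utt s0 t0 <= 0).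
  { apply (second_derivative_at_max (U s0) (Ut s0) t0 _ 1); [lra| | |].
    - intros y _. apply J1; lra.
    - apply J3; lra.
    - intros y _. specialize (Hmax' s0 y ltac:(lra)). lra. }
  lra.
Qed.

Lemma cos_sin_reduce t : exists t', 0 <= t' <= 2 * PI /\ cos t = cos t' /\ sin t = sin t'.
Proof.
  pose proof two_PI_pos as Hpi.
  assert (Hn : forall x, 0 <= x -> exists k, INR k * (2 * PI) <= x <= INR k * (2 * PI) + 2 * PI).
  { intros x Hx. assert (Hq : 0 <= x / (2 * PI)) by (now apply Rdiv_le_0_compat).
    destruct (nfloor_ex _ Hq) as [k [Hk1 Hk2]]. exists k.
    replace x with (x / (2 * PI) * (2 * PI)) by (field; lra). nra. }
  destruct (Rle_or_lt 0 t) as [Ht|Ht].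
  - destruct (Hn t Ht) as [k Hk]. exists (t - INR k * (2 * PI)). split; [lra|].
    replace t with (t - INR k * (2 * PI) + 2 * INR k * PI) at 1 3 by ring.
    now rewrite cos_period, sin_period.
  - destruct (Hn (- t)) as [k Hk]; [lra|].
    (* Here [- t] lies between [k] and [k + 1] periods, so [k + 1] of them must be added. *)
    exists (t + 2 * INR (k + 1) * PI). rewrite cos_period, sin_period.
    split; [|easy]. rewrite plus_INR. simpl. lra.
Qed.

Lemma periodic2_logpolar cx cy f (g : R -> R) :
  periodic2 (fun s t => logpolar cx cy f s t + g s).
Proof.
  intros t. destruct (cos_sin_reduce t) as (t' & Ht' & Ec & Es).
  exists t'. split; [easy|]. intros s. unfold logpolar. now rewrite Ec, Es.
Qed.

(** * Asymptotics of the metric in the strip *)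

Lemma ln_minus_le x y : 0 < x -> 0 < y -> ln x - ln y <= (x - y) / y.
Proof.
  intros Hx Hy. rewrite <- ln_div by easy.
  pose proof (exp_ineq1_le (ln (x / y))) as H.
  rewrite exp_ln in H by (now apply Rdiv_lt_0_compat).
  replace ((x - y) / y) with (x / y - 1) by (field; lra). lra.
Qed.

(** Translating the barriers does not change their asymptotics; hence the comparison can start at
    any [s]. *)
Lemma ln_shift_asymptotic A eps : 0 < eps ->
  exists S, S < 0 /\ S < A /\ forall s, s < S -> Rabs (ln (- s) - ln (A - s)) < eps.
Proof.
  intros He. set (Q := (Rabs A + 1) / eps).
  assert (HQ : 0 < Q).
  { pose proof (Rabs_pos A). apply Rdiv_lt_0_compat; lra. }
  pose proof (Rle_abs A). pose proof (Rle_abs (- A)) as HA. rewrite Rabs_Ropp in HA.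
  exists (- (Q + Rabs A) - 1). pose proof (Rabs_pos A).
  split; [lra|split; [lra|]]. intros s Hs.
  assert (Hx : 0 < - s) by lra. assert (Hy : 0 < A - s) by lra.
  pose proof (ln_minus_le _ _ Hx Hy) as H1. pose proof (ln_minus_le _ _ Hy Hx) as H2.
  assert (HB : forall B y, Rabs B <= Rabs A -> Q < y -> B / y < eps).
  { intros B y HB Hyy. apply Rmult_lt_reg_r with y; [lra|].
    replace (B / y * y) with B by (field; lra).
    apply Rlt_trans with (eps * Q); [|now apply Rmult_lt_compat_l].
    replace (eps * Q) with (Rabs A + 1) by (unfold Q; field; lra).
    pose proof (Rle_abs B). lra. }
  apply Rabs_def1.
  - apply Rle_lt_trans with (1 := H1). apply HB; [|lra].
    replace (- s - (A - s)) with (- A) by ring. rewrite Rabs_Ropp. lra.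
  - enough (ln (A - s) - ln (- s) < eps) by lra.
    apply Rle_lt_trans with (1 := H2). apply HB; [|lra].
    replace (A - s - - s) with A by ring. lra.
Qed.

(** Both [e^(C t) g] and [- e^(- C t) g] are nondecreasing. This integrates the differential Harnack
    inequality along a circle. *)
Lemma gronwall (g g' : R -> R) C a b :
  a <= b -> (forall t, is_derive g t (g' t)) -> (forall t, Rabs (g' t) <= C * g t) ->
  g a <= exp (C * (b - a)) * g b /\ g b <= exp (C * (b - a)) * g a.
Proof.
  intros Hab Hd Hb.
  assert (H1 : exp (C * a) * g a <= exp (C * b) * g b).
  { apply (nondecreasing_of_derive_nonneg (fun t => exp (C * t) * g t)
      (fun t => exp (C * t) * (C * g t + g' t))); [easy| |].
    - intros t _. evar_last.
      + apply (is_derive_mult (fun t => exp (C * t)) g); [|apply Hd|].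
        * auto_derive; trivial.
        * intros; apply Rmult_comm.
      + unfold plus, mult; simpl. ring.
    - intros t _. apply Rmult_le_pos; [left; apply exp_pos|].
      specialize (Hb t). apply Rabs_le_between in Hb. lra. }
  assert (H2 : - (exp (- C * a) * g a) <= - (exp (- C * b) * g b)).
  { apply (nondecreasing_of_derive_nonneg (fun t => - (exp (- C * t) * g t))
      (fun t => exp (- C * t) * (C * g t - g' t))); [easy| |].
    - intros t _. evar_last.
      + apply (is_derive_opp (fun t => exp (- C * t) * g t)).
        apply (is_derive_mult (fun t => exp (- C * t)) g); [|apply Hd|].
        * auto_derive; trivial.
        * intros; apply Rmult_comm.
      + unfold plus, mult, opp; simpl. ring.
    - intros t _. apply Rmult_le_pos; [left; apply exp_pos|].
      specialize (Hb t). apply Rabs_le_between in Hb. lra. }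
  split.
  - apply Rmult_le_reg_l with (exp (C * a)); [apply exp_pos|].
    rewrite <- Rmult_assoc, <- exp_plus.
    now replace (C * a + C * (b - a)) with (C * b) by ring.
  - apply Rmult_le_reg_l with (exp (- C * b)); [apply exp_pos|].
    rewrite <- Rmult_assoc, <- exp_plus.
    replace (- C * b + C * (b - a)) with (- C * a) by ring. lra.
Qed.

Lemma C2_jet_opp D f fx fy fxx fxy fyy :
  C2_jet D f fx fy fxx fxy fyy ->
  C2_jet D (fun x y => - f x y) (fun x y => - fx x y) (fun x y => - fy x y)
    (fun x y => - fxx x y) (fun x y => - fxy x y) (fun x y => - fyy x y).
Proof. intros (H1 & H2 & H3). split; [|split]; now apply C1_jet_opp. Qed.

Lemma C2_jet_plus_const D f fx fy fxx fxy fyy c :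
  C2_jet D f fx fy fxx fxy fyy -> C2_jet D (fun x y => f x y + c) fx fy fxx fxy fyy.
Proof.
  intros (H1 & H2 & H3). split; [|now split].
  apply C1_jet_ext with (4 := C1_jet_plus _ _ _ _ _ _ _ H1 (C1_jet_const D c));
  intros; ring.
Qed.

Lemma half_plane_disc S x : x + 2 < S -> forall s t, s < ln 2 ->
  x + exp s * cos t < S.
Proof.
  intros Hx s t Hs.
  assert (exp s < 2).
  { rewrite <- (exp_ln 2) by lra. now apply exp_increasing. }
  pose proof (COS_bound t). pose proof (exp_pos s). nra.
Qed.

Lemma ln2_pos : 0 < ln 2.
Proof. rewrite <- ln_1. apply ln_increasing; lra. Qed.

Lemma unit_disc_bound x s t : s <= 0 -> x - 1 <= x + exp s * cos t <= x + 1.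
Proof.
  intros Hs. assert (exp s <= 1).
  { rewrite <- exp_0. destruct Hs as [Hs| ->]; [left; now apply exp_increasing|lra]. }
  pose proof (COS_bound t). pose proof (exp_pos s). nra.
Qed.

Section Asymptotics.

Context (U Us Ut Uss Ust Utt k : R -> R -> R) (S0 k0 : R)
  (J : C2_jet (fun s _ => s < S0) U Us Ut Uss Ust Utt)
  (Hper : periodic2 U)
  (Heq : forall s t, s < S0 -> Uss s t + Utt s t = k s t * exp (2 * U s t))
  (Hk0 : 0 < k0)
  (Hk : forall eps, 0 < eps -> exists S, forall s t, s < S -> Rabs (k s t - k0) < eps).

Lemma strip_bound s1 s2 : s1 <= s2 < S0 ->
  exists B, forall s t, s1 <= s <= s2 -> Rabs (U s t) <= B.
Proof.
  intros Hs. pose proof two_PI_pos.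
  destruct (rectangle_max (fun s t => Rabs (U s t)) s1 s2 0 (2 * PI)) as (s0 & t0 & _ & _ & Hm);
    try lra.
  { intros x y Hx _. apply (continuity_1d_2d_pt_comp Rabs U); [apply Rcontinuity_abs|].
    apply (C1_jet_continuity (fun s _ => s < S0) U Us Ut);
      [apply open2_half_plane|apply J|lra]. }
  exists (Rabs (U s0 t0)). intros s t Hst.
  destruct (Hper t) as (t' & Ht' & E). rewrite E. now apply Hm.
Qed.

(* Ahlfors' lemma on the strip: [1 / t + 1 / (L - t)], [t = S1 - s], is the density of
   a metric of curvature at least -1 that blows up at both ends of the strip. *)
Lemma upper_bound a S1 : 0 < a -> S1 < S0 ->
  (forall s t, s < S1 -> a <= k s t) ->
  forall s t, s < S1 -> U s t <= - ln (S1 - s) - ln a / 2.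
Proof.
  intros Ha HS1 Hka s t Hs. apply le_epsilon. intros eps He.
  assert (Hexp : 0 < exp (- eps) < 1).
  { split; [apply exp_pos|]. rewrite <- exp_0. apply exp_increasing. lra. }
  (* [L] solves [L - (S1 - s) = L e^(- eps)]: at the point [s] the barrier exceeds the claimed bound
     by exactly [eps]. *)
  set (L := (S1 - s) / (1 - exp (- eps))).
  assert (HL0 : 0 < L) by (apply Rdiv_lt_0_compat; lra).
  assert (HL : L - (S1 - s) = L * exp (- eps)) by (unfold L; field; lra).
  assert (HLs : S1 - s < L) by nra.
  (* Logarithm of [(1 / p + 1 / q) / sqrt a], where [p = S1 - x] and [q = x - (S1 - L)], using
     [p + q = L]. *)
  set (h := fun x => - ln (S1 - x) - ln (x - (S1 - L)) + ln L - ln a / 2).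
  assert (Hhs : h s = - ln (S1 - s) - ln a / 2 + eps).
  { unfold h. replace (s - (S1 - L)) with (L * exp (- eps)) by lra.
    rewrite ln_mult, ln_exp by lra. lra. }
  rewrite <- Hhs.
  destruct (strip_bound (S1 - L) S1 ltac:(lra)) as [B HB].
  (* The margin [eta] keeps [s] inside the shortened strip and is so small that the poles of the
     barrier lift [h] above the bound [B] of [U] at both ends. *)
  set (eta := Rmin (Rmin ((S1 - s) / 2) ((L - (S1 - s)) / 2)) (exp (- B - ln a / 2))).
  assert (eta <= (S1 - s) / 2 /\ eta <= (L - (S1 - s)) / 2 /\ eta <= exp (- B - ln a / 2)
          /\ 0 < eta) as (He1 & He2 & He3 & He0).
  { unfold eta.
    pose proof (Rmin_l (Rmin ((S1 - s) / 2) ((L - (S1 - s)) / 2)) (exp (- B - ln a / 2))).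
    pose proof (Rmin_r (Rmin ((S1 - s) / 2) ((L - (S1 - s)) / 2)) (exp (- B - ln a / 2))).
    pose proof (Rmin_l ((S1 - s) / 2) ((L - (S1 - s)) / 2)).
    pose proof (Rmin_r ((S1 - s) / 2) ((L - (S1 - s)) / 2)).
    split; [lra|split; [lra|split; [lra|]]].
    apply Rmin_pos; [apply Rmin_pos; lra|apply exp_pos]. }
  assert (Hlne : ln eta <= - B - ln a / 2).
  { rewrite <- (ln_exp (- B - ln a / 2)). now apply ln_le. }
  assert (HlnL : ln (L - eta) <= ln L) by (apply ln_le; lra).
  apply (periodic_strip_comparison U Us Ut Uss Ust Utt h
    (fun x => / (S1 - x) - / (x - (S1 - L)))
    (fun x => / (S1 - x) ^ 2 + / (x - (S1 - L)) ^ 2) S0 (S1 - L + eta) (S1 - eta));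
    trivial; try lra.
  - intros x Hx. unfold h. auto_derive; [lra|]. field. lra.
  - intros x Hx. auto_derive; [lra|]. field. lra.
  - intros y. assert (K := HB (S1 - L + eta) y ltac:(lra)).
    apply Rabs_le_between in K. unfold h.
    replace (S1 - (S1 - L + eta)) with (L - eta) by ring.
    replace (S1 - L + eta - (S1 - L)) with eta by ring. lra.
  - intros y. assert (K := HB (S1 - eta) y ltac:(lra)).
    apply Rabs_le_between in K. unfold h.
    replace (S1 - (S1 - eta)) with eta by ring.
    replace (S1 - eta - (S1 - L)) with (L - eta) by ring. lra.
  - intros x y Hx Hlt. rewrite Heq by lra.
    set (p := S1 - x). set (q := x - (S1 - L)).
    assert (Hp : 0 < p) by (unfold p; lra). assert (Hq : 0 < q) by (unfold q; lra).
    assert (HpqL : p + q = L) by (unfold p, q; ring).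
    assert (Eh : a * exp (2 * h x) = (/ p + / q) ^ 2).
    { replace (2 * h x) with (- ln a + (ln L - ln p - ln q + (ln L - ln p - ln q)))
        by (unfold h, p, q; field).
      unfold Rminus. rewrite !exp_plus, !exp_Ropp, !exp_ln by easy.
      rewrite <- HpqL. field. lra. }
    assert (Hexp2 : a * exp (2 * h x) < k x y * exp (2 * U x y)).
    { apply Rlt_le_trans with (a * exp (2 * U x y)).
      - apply Rmult_lt_compat_l; [easy|]. apply exp_increasing. lra.
      - apply Rmult_le_compat_r; [left; apply exp_pos|]. apply Hka. lra. }
    (* What remains is [1 / p^2 + 1 / q^2 < (1 / p + 1 / q)^2]; the cross term supplies
       strictness. *)
    rewrite Eh in Hexp2. apply Rle_lt_trans with (2 := Hexp2).
    assert (0 < / p) by now apply Rinv_0_lt_compat.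
    assert (0 < / q) by now apply Rinv_0_lt_compat.
    rewrite <- !pow_inv. nra.
Qed.

(* Comparison with the density [exp (- c t) / t], [t = T - s], whose curvature is at
   most -1; the factor [exp (- c t)] forces the comparison at minus infinity. *)
Lemma lower_bound b S2 T : 0 < b -> S2 < S0 -> S2 < T ->
  (forall s t, s <= S2 -> k s t <= b) ->
  (forall t, - ln (T - S2) - ln b / 2 <= U S2 t) ->
  (forall c, 0 < c -> exists S, forall s t, s < S -> c * s <= U s t) ->
  forall s t, s <= S2 -> - ln (T - s) - ln b / 2 <= U s t.
Proof.
  intros Hb HS2 HT Hkb Hbd Hgrowth s t Hs. apply le_epsilon. intros eps He.
  (* With this [c] the damping term [c (T - s)] costs exactly [eps] at the point [s]. *)
  set (c := eps / (T - s)).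
  assert (Hc : 0 < c) by (apply Rdiv_lt_0_compat; lra).
  set (h := fun x => - ln (T - x) - c * (T - x) - ln b / 2).
  enough (- U s t <= - h s).
  { unfold h in H. replace (c * (T - s)) with eps in H by (unfold c; field; lra). lra. }
  destruct (Hgrowth (c / 2) ltac:(lra)) as [S HS].
  (* At [s1] the barrier is at most [c / 2 s1], hence below [U] by the growth hypothesis: [T - 1]
     makes [ln (T - s1)] nonnegative, and the last entry lets the other half of [c s1] absorb [c T]
     and [ln b / 2]. *)
  set (s1 := Rmin (Rmin (s - 1) (S - 1)) (Rmin (T - 1) (2 * T + ln b / c))).
  assert (s1 <= s - 1 /\ s1 <= S - 1 /\ s1 <= T - 1 /\ s1 <= 2 * T + ln b / c)
    as (L1 & L2 & L3 & L4).
  { unfold s1.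
    pose proof (Rmin_l (Rmin (s - 1) (S - 1)) (Rmin (T - 1) (2 * T + ln b / c))).
    pose proof (Rmin_r (Rmin (s - 1) (S - 1)) (Rmin (T - 1) (2 * T + ln b / c))).
    pose proof (Rmin_l (s - 1) (S - 1)). pose proof (Rmin_r (s - 1) (S - 1)).
    pose proof (Rmin_l (T - 1) (2 * T + ln b / c)).
    pose proof (Rmin_r (T - 1) (2 * T + ln b / c)). lra. }
  apply (periodic_strip_comparison (fun s t => - U s t) (fun s t => - Us s t)
    (fun s t => - Ut s t) (fun s t => - Uss s t) (fun s t => - Ust s t)
    (fun s t => - Utt s t) (fun x => - h x)
    (fun x => - (/ (T - x) + c)) (fun x => - / (T - x) ^ 2) S0 s1 S2); try lra.
  - now apply C2_jet_opp.
  - intros y. destruct (Hper y) as (y' & Hy' & E). exists y'. split; [easy|].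
    intros x. now rewrite E.
  - intros x Hx. unfold h. auto_derive; [lra|]. field. lra.
  - intros x Hx. auto_derive; [lra|]. field. lra.
  - intros y. apply Ropp_le_contravar. specialize (HS s1 y ltac:(lra)). unfold h.
    assert (0 <= ln (T - s1)) by (rewrite <- ln_1; apply ln_le; lra).
    apply Rmult_le_compat_l with (r := c / 2) in L4; [|lra].
    replace (c / 2 * (2 * T + ln b / c)) with (c * T + ln b / 2) in L4 by (field; lra).
    lra.
  - intros y. apply Ropp_le_contravar. specialize (Hbd y). unfold h.
    assert (0 < c * (T - S2)) by (apply Rmult_lt_0_compat; lra). lra.
  - intros x y Hx Hlt.
    enough (k x y * exp (2 * U x y) < / (T - x) ^ 2) by (specialize (Heq x y); lra).
    apply Rle_lt_trans with (b * exp (2 * U x y)).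
    { apply Rmult_le_compat_r; [left; apply exp_pos|]. apply Hkb. lra. }
    apply Rlt_le_trans with (b * exp (2 * h x)).
    { apply Rmult_lt_compat_l; [easy|]. apply exp_increasing. lra. }
    assert (Hp : 0 < T - x) by lra.
    replace (2 * h x) with (- ln b + (- ln (T - x) + - ln (T - x)) + - (2 * c * (T - x)))
      by (unfold h; field).
    rewrite !exp_plus, !(exp_Ropp (ln _)), !exp_ln by easy.
    assert (H1 : exp (- (2 * c * (T - x))) <= 1).
    { rewrite <- exp_0. left. apply exp_increasing.
      assert (0 < c * (T - x)) by (now apply Rmult_lt_0_compat). lra. }
    replace (b * (/ b * (/ (T - x) * / (T - x)) * exp (- (2 * c * (T - x)))))
      with (/ (T - x) ^ 2 * exp (- (2 * c * (T - x)))) by (field; lra).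
    rewrite <- (Rmult_1_r (/ (T - x) ^ 2)) at 2.
    apply Rmult_le_compat_l; [|easy]. left. apply Rinv_0_lt_compat. nra.
Qed.

Lemma upper_asymptotic eps : 0 < eps -> exists S, S < 0 /\ S < S0 /\
  forall s t, s < S -> U s t <= - ln (- s) - ln k0 / 2 + eps.
Proof.
  intros He.
  assert (Hexp : 0 < exp (- eps) < 1).
  { split; [apply exp_pos|]. rewrite <- exp_0. apply exp_increasing. lra. }
  (* This radius gives [k >= k0 e^(- eps)] far to the left. The factor costs [eps / 2] in the bound,
     and the shift of the logarithm costs the other half. *)
  destruct (Hk (k0 * (1 - exp (- eps)))) as [S HS]; [nra|].
  set (S1 := Rmin S (S0 - 1)).
  assert (S1 <= S /\ S1 <= S0 - 1) as [H1 H2].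
  { split; [apply Rmin_l|apply Rmin_r]. }
  destruct (ln_shift_asymptotic S1 (eps / 2)) as (S2 & HS2 & HS2' & Hln); [lra|].
  exists S2. split; [easy|split; [lra|]]. intros s t Hs.
  assert (Ha : 0 < k0 * exp (- eps)) by nra.
  assert (H := upper_bound (k0 * exp (- eps)) S1 Ha ltac:(lra)).
  assert (Hka : forall s t, s < S1 -> k0 * exp (- eps) <= k s t).
  { intros x y Hx. specialize (HS x y ltac:(lra)). apply Rabs_lt_between in HS. lra. }
  specialize (H Hka s t ltac:(lra)). rewrite ln_mult, ln_exp in H by lra.
  specialize (Hln s Hs). apply Rabs_lt_between in Hln. lra.
Qed.

(** The upper bound alone makes [e^(2 U)] of order [1 / s^2], so the Laplacian of [U] tends to 0;
    this is available before any lower bound and feeds the Harnack inequality. *)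
Lemma exp_2U_small eps : 0 < eps -> exists S, S < 0 /\ S < S0 /\
  forall s t, s < S -> exp (2 * U s t) <= eps /\ Rabs (k s t * exp (2 * U s t)) <= eps.
Proof.
  intros He.
  destruct (upper_asymptotic 1 Rlt_0_1) as (S1 & H1 & H1' & HU).
  destruct (Hk 1 Rlt_0_1) as [S2 HS2].
  set (eps' := eps / (k0 + 1)).
  assert (He' : 0 < eps') by (apply Rdiv_lt_0_compat; lra).
  assert (Ele : eps' <= eps).
  { unfold eps'. apply Rmult_le_reg_r with (k0 + 1); [lra|]. field_simplify; nra. }
  (* For [- s >= Q] the upper bound with error 1 reads [2 U <= ln eps']. *)
  set (Q := exp (- ln k0 / 2 + 1 - ln eps' / 2)).
  set (S := Rmin S1 (Rmin S2 (- Q))).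
  assert (S <= S1 /\ S <= S2 /\ S <= - Q) as (L1 & L2 & L3).
  { unfold S. pose proof (Rmin_l S1 (Rmin S2 (- Q))). pose proof (Rmin_r S1 (Rmin S2 (- Q))).
    pose proof (Rmin_l S2 (- Q)). pose proof (Rmin_r S2 (- Q)). lra. }
  exists S. split; [lra|split; [lra|]]. intros s t Hs.
  specialize (HU s t ltac:(lra)). specialize (HS2 s t ltac:(lra)).
  assert (HQ : - ln k0 / 2 + 1 - ln eps' / 2 <= ln (- s)).
  { rewrite <- (ln_exp (- ln k0 / 2 + 1 - ln eps' / 2)). fold Q.
    apply ln_le; [apply exp_pos|lra]. }
  assert (E : exp (2 * U s t) <= eps').
  { rewrite <- (exp_ln eps') by easy.
    destruct (Req_dec (2 * U s t) (ln eps')) as [->|]; [lra|].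
    left. apply exp_increasing. lra. }
  pose proof (exp_pos (2 * U s t)) as Hp.
  split; [lra|]. apply Rabs_lt_between in HS2.
  rewrite Rabs_mult, (Rabs_pos_eq (exp _)) by lra.
  replace eps with ((k0 + 1) * eps') by (unfold eps'; field; lra).
  apply Rmult_le_compat; [apply Rabs_pos|lra| |easy].
  apply Rabs_le. lra.
Qed.

Section Growth.

Context (Horder : forall c, 0 < c -> exists S, forall s, s < S -> exists t, c * s <= U s t).

(* Harnack: [- U] is nonnegative and almost harmonic, so its maximum on a circle is
   controlled by its minimum, which the order makes sublinear. *)
Lemma sublinear_growth c : 0 < c -> exists S, forall s t, s < S -> c * s <= U s t.
Proof.
  intros Hc. pose proof two_PI_pos as Hpi.
  destruct (exp_2U_small 1 Rlt_0_1) as (S1 & H1 & H1' & HU).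
  (* Harnack constant: the gradient estimate has factor 2 and the two points are at most [2 PI]
     apart. *)
  set (A := exp (2 * (2 * PI))).
  assert (HA : 1 <= A).
  { unfold A. rewrite <- exp_0. left. apply exp_increasing. lra. }
  set (c' := c / A / 2).
  assert (Hc' : 0 < c').
  { unfold c'. apply Rdiv_lt_0_compat; [apply Rdiv_lt_0_compat; lra|lra]. }
  destruct (Horder c' Hc') as [S2 HS2].
  set (S := Rmin (S1 - 2) (Rmin S2 (- (2 * A / c)))).
  assert (S <= S1 - 2 /\ S <= S2 /\ S <= - (2 * A / c)) as (L1 & L2 & L3).
  { unfold S. pose proof (Rmin_l (S1 - 2) (Rmin S2 (- (2 * A / c)))).
    pose proof (Rmin_r (S1 - 2) (Rmin S2 (- (2 * A / c)))).
    pose proof (Rmin_l S2 (- (2 * A / c))). pose proof (Rmin_r S2 (- (2 * A / c))). lra. }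
  exists S. intros s t Hs.
  assert (Hneg : forall x y, x < S1 -> 0 <= - U x y).
  { intros x y Hx. destruct (HU x y Hx) as [K _]. rewrite <- exp_0 in K.
    destruct (Rle_or_lt (U x y) 0) as [|Hlt]; [lra|].
    assert (exp 0 < exp (2 * U x y)) by (apply exp_increasing; lra). lra. }
  (* Adding 1 to [- U] absorbs the bound 1 on the Laplacian and makes the estimate linear, as
     [gronwall] requires. *)
  assert (Hgrad : forall y, Rabs (- Ut s y) <= 2 * (- U s y + 1)).
  { intros y. replace (2 * (- U s y + 1)) with (2 * - U s y + 2 * 1) by ring.
    apply (gradient_estimate_nonneg (fun s _ => s < S0) (fun s t => - U s t)
      (fun s t => - Us s t) (fun s t => - Ut s t) (fun s t => - Uss s t)
      (fun s t => - Ust s t) (fun s t => - Utt s t) s y (ln 2)).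
    - apply open2_half_plane.
    - now apply C2_jet_opp.
    - apply ln2_pos.
    - lra.
    - intros; apply half_plane_disc; trivial; lra.
    - intros x. apply Hneg. pose proof (unit_disc_bound s 0 x (Rle_refl 0)). lra.
    - intros x z Hx. unfold logpolar.
      pose proof (unit_disc_bound s x z Hx).
      match goal with |- Rabs (- Uss ?u ?v + - Utt ?u ?v) <= 1 =>
        replace (- Uss u v + - Utt u v) with (- (k u v * exp (2 * U u v)))
          by (rewrite <- Heq; lra) end.
      rewrite Rabs_Ropp. apply HU. lra. }
  destruct (HS2 s ltac:(lra)) as [t0 Ht0].
  destruct (Hper t0) as (t1 & Ht1 & E1). rewrite E1 in Ht0.
  destruct (Hper t) as (t2 & Ht2 & E2). rewrite E2.
  assert (Hd : forall y, is_derive (fun y => - U s y + 1) y (- Ut s y)).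
  { intros y. evar_last.
    - apply (is_derive_plus (fun y => - U s y) (fun _ => 1)).
      + apply (is_derive_opp (U s)).
        exact (proj1 (proj2 (proj1 J s y ltac:(lra)))).
      + apply (is_derive_const (K := R_AbsRing) (V := R_NormedModule)).
    - unfold plus, opp, zero; simpl. ring. }
  assert (HG : - U s t2 + 1 <= A * (- U s t1 + 1)).
  { assert (Hp : 0 <= - U s t1 + 1) by (specialize (Hneg s t1 ltac:(lra)); lra).
    assert (HAe : forall d, d <= 2 * PI -> exp (2 * d) * (- U s t1 + 1) <= A * (- U s t1 + 1)).
    { intros d Hdd. apply Rmult_le_compat_r; [easy|]. unfold A.
      destruct Hdd as [Hdd| ->]; [left; apply exp_increasing; lra|lra]. }
    destruct (Rle_or_lt t1 t2) as [Hle|Hlt].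
    - destruct (gronwall _ _ 2 t1 t2 Hle Hd Hgrad) as [_ K].
      apply Rle_trans with (1 := K). apply HAe. lra.
    - destruct (gronwall _ _ 2 t2 t1 ltac:(lra) Hd Hgrad) as [K _].
      apply Rle_trans with (1 := K). apply HAe. lra. }
  (* The choice [c' = c / (2 A)] leaves [- (c / 2) s + A], and the remaining half of [c s] pays for
     [A] once [s] is below [- 2 A / c]. *)
  assert (K1 : A * (- U s t1 + 1) <= A * (- (c' * s) + 1)).
  { apply Rmult_le_compat_l; lra. }
  replace (A * (- (c' * s) + 1)) with (- (c / 2) * s + A) in K1 by (unfold c'; field; lra).
  assert (K2 : c / 2 * s <= - A).
  { replace (- A) with (c / 2 * (- (2 * A / c))) by (field; lra).
    apply Rmult_le_compat_l; lra. }
  lra.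
Qed.

Lemma lower_asymptotic eps : 0 < eps -> exists S, S < 0 /\ S < S0 /\
  forall s t, s < S -> - ln (- s) - ln k0 / 2 - eps <= U s t.
Proof.
  intros He.
  assert (Hexp : 1 < exp eps).
  { rewrite <- exp_0. apply exp_increasing. lra. }
  destruct (Hk (k0 * (exp eps - 1))) as [S HS]; [apply Rmult_lt_0_compat; lra|].
  set (S2 := Rmin (S - 1) (S0 - 1)).
  assert (S2 <= S - 1 /\ S2 <= S0 - 1) as [H1 H2].
  { split; [apply Rmin_l|apply Rmin_r]. }
  set (b := k0 * exp eps).
  assert (Hb : 0 < b) by (apply Rmult_lt_0_compat; lra).
  destruct (strip_bound S2 S2 ltac:(lra)) as [B HB].
  (* [T] makes the barrier equal to [- B] on the circle [s = S2], so the boundary condition there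
     holds by the bound on [U]. *)
  set (T := S2 + exp (B - ln b / 2)).
  pose proof (exp_pos (B - ln b / 2)) as HTp.
  assert (Hlow : forall s t, s <= S2 -> - ln (T - s) - ln b / 2 <= U s t).
  { apply lower_bound; trivial; try (unfold T; lra).
    - intros s t Hs. specialize (HS s t ltac:(lra)). apply Rabs_lt_between in HS.
      unfold b. lra.
    - intros t. specialize (HB S2 t ltac:(lra)). apply Rabs_le_between in HB.
      replace (T - S2) with (exp (B - ln b / 2)) by (unfold T; ring).
      rewrite ln_exp. lra.
    - apply sublinear_growth. }
  destruct (ln_shift_asymptotic T (eps / 2)) as (S3 & HS3 & HS3' & Hln); [lra|].
  exists (Rmin S3 S2). split; [apply Rle_lt_trans with (1 := Rmin_l _ _); lra|].
  split; [apply Rle_lt_trans with (1 := Rmin_r _ _); lra|]. intros s t Hs.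
  pose proof (Rmin_l S3 S2). pose proof (Rmin_r S3 S2).
  specialize (Hlow s t ltac:(lra)). specialize (Hln s ltac:(lra)).
  apply Rabs_lt_between in Hln. unfold b in Hlow.
  rewrite ln_mult, ln_exp in Hlow by lra. lra.
Qed.

Lemma asymptotic eps : 0 < eps -> exists S, S < 0 /\ S < S0 /\
  forall s t, s < S -> Rabs (U s t + (ln (- s) + ln k0 / 2)) <= eps.
Proof.
  intros He.
  destruct (upper_asymptotic eps He) as (S1 & H1 & H1' & HU).
  destruct (lower_asymptotic eps He) as (S2 & H2 & H2' & HL).
  pose proof (Rmin_l S1 S2). pose proof (Rmin_r S1 S2).
  exists (Rmin S1 S2). split; [lra|split; [lra|]]. intros s t Hs.
  specialize (HU s t ltac:(lra)). specialize (HL s t ltac:(lra)).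
  apply Rabs_le. lra.
Qed.

(** The derivative of [ln (- s)] is [1 / s], so over a unit interval far to the left the logarithm
    is nearly constant and its value at the centre [s0] can stand for it. *)
Lemma asymptotic_unit_disc eps : 0 < eps -> exists S, S < 0 /\ S < S0 /\
  forall s0 s t, s0 < S -> s0 - 1 <= s <= s0 + 1 ->
  Rabs (U s t + (ln (- s0) + ln k0 / 2)) <= eps.
Proof.
  intros He.
  destruct (asymptotic (eps / 2)) as (S1 & H1 & H1' & HU); [lra|].
  assert (Hq : 0 < 2 / eps) by (apply Rdiv_lt_0_compat; lra).
  set (S := Rmin (S1 - 1) (- (2 / eps) - 1)).
  assert (S <= S1 - 1 /\ S <= - (2 / eps) - 1) as [L1 L2].
  { split; [apply Rmin_l|apply Rmin_r]. }
  exists S. split; [lra|split; [lra|]]. intros s0 s t Hs0 Hs.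
  specialize (HU s t ltac:(lra)).
  assert (Hln : forall x y, - y > 2 / eps -> - x > 0 -> - x + y <= 1 ->
    ln (- x) - ln (- y) <= eps / 2).
  { intros x y Hy Hx Hxy. apply Rle_trans with (1 := ln_minus_le (- x) (- y) ltac:(lra) ltac:(lra)).
    apply Rmult_le_reg_r with (- y); [lra|].
    replace ((- x - - y) / - y * - y) with (- x + y) by (field; lra).
    apply Rle_trans with (1 := Hxy).
    replace 1 with (eps / 2 * (2 / eps)) by (field; lra).
    apply Rmult_le_compat_l; lra. }
  pose proof (Hln s s0 ltac:(lra) ltac:(lra) ltac:(lra)).
  pose proof (Hln s0 s ltac:(lra) ltac:(lra) ltac:(lra)).
  apply Rabs_le_between in HU. apply Rabs_le. lra.
Qed.

(** The interior estimate is applied to [U] plus the constant [ln (- s) + ln k0 / 2] with [s] frozen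
    at the centre; this changes neither derivatives nor Laplacian. *)
Lemma gradient_small eps : 0 < eps -> exists S, S < 0 /\ S < S0 /\
  forall s t, s < S -> Rabs (Us s t) <= eps /\ Rabs (Ut s t) <= eps.
Proof.
  intros He.
  destruct (asymptotic_unit_disc (eps / 4)) as (S1 & H1 & H1' & HU); [lra|].
  destruct (exp_2U_small (eps / 4)) as (S2 & H2 & H2' & HF); [lra|].
  pose proof (Rmin_l (S1 - 2) (S2 - 2)). pose proof (Rmin_r (S1 - 2) (S2 - 2)).
  exists (Rmin (S1 - 2) (S2 - 2)). split; [lra|split; [lra|]]. intros s t Hs.
  replace eps with (4 * (eps / 4)) by field.
  apply (gradient_estimate (fun s _ => s < S0)
    (fun x y => U x y + (ln (- s) + ln k0 / 2)) Us Ut Uss Ust Utt s t (ln 2)).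
  - apply open2_half_plane.
  - now apply C2_jet_plus_const.
  - apply ln2_pos.
  - lra.
  - intros; apply half_plane_disc; trivial; lra.
  - intros y. apply HU; [lra|]. apply unit_disc_bound. lra.
  - intros x y Hx. unfold logpolar. pose proof (unit_disc_bound s x y Hx).
    rewrite Heq by lra. apply HF. lra.
Qed.

Context (M gamma : R) (Hgamma : 0 < gamma <= 1)
  (Hholder : exists S, forall s0 t0 s t, s0 < S -> s <= 0 ->
    Rabs (k (s0 + exp s * cos t) (t0 + exp s * sin t) - k s0 t0) <= M * exp (gamma * s)).

(** The Laplacian [k e^(2 U)] has a small Holder constant on unit discs: [k] is Holder, [e^(2 U)] is
    Lipschitz by the gradient bound, and both contributions carry the small factor [sup e^(2 U)]. *)
Lemma hessian_small eps : 0 < eps -> exists S, S < 0 /\ S < S0 /\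
  forall s t, s < S ->
  Rabs (Uss s t) <= eps /\ Rabs (Ust s t) <= eps /\ Rabs (Utt s t) <= eps.
Proof.
  intros He.
  assert (Hg : 0 < / gamma) by (apply Rinv_0_lt_compat; lra).
  set (d := Rmin 1 (eps / (8 * (1 + / gamma)))).
  assert (Hd : 0 < d).
  { apply Rmin_pos; [lra|]. apply Rdiv_lt_0_compat; lra. }
  assert (Hd1 : d <= 1) by apply Rmin_l.
  assert (Hd2 : 8 * d * (1 + / gamma) <= eps).
  { replace eps with (8 * (eps / (8 * (1 + / gamma))) * (1 + / gamma)) by (field; lra).
    apply Rmult_le_compat_r; [lra|]. apply Rmult_le_compat_l; [lra|]. apply Rmin_r. }
  (* [e] bounds [e^(2 U)]. The oscillation of [k] contributes [|M| e] and that of [e^(2 U)]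
     contributes [4 (k0 + 1) e], together at most [d]. *)
  set (e := d / (1 + Rabs M + 4 * (k0 + 1))).
  pose proof (Rabs_pos M) as HM.
  assert (He0 : 0 < e) by (apply Rdiv_lt_0_compat; lra).
  assert (He1 : e * (1 + Rabs M + 4 * (k0 + 1)) = d) by (unfold e; field; lra).
  destruct (asymptotic_unit_disc d Hd) as (S1 & H1 & H1' & HU).
  destruct (exp_2U_small e He0) as (S2 & H2 & H2' & HF).
  destruct (gradient_small 1 Rlt_0_1) as (S3 & H3 & H3' & HG).
  destruct Hholder as [S4 HH].
  destruct (Hk 1 Rlt_0_1) as [S5 HK].
  set (S := Rmin S1 (Rmin S2 (Rmin S3 (Rmin S4 S5)))).
  assert (S <= S1 /\ S <= S2 /\ S <= S3 /\ S <= S4 /\ S <= S5) as (L1 & L2 & L3 & L4 & L5).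
  { unfold S.
    pose proof (Rmin_l S1 (Rmin S2 (Rmin S3 (Rmin S4 S5)))).
    pose proof (Rmin_r S1 (Rmin S2 (Rmin S3 (Rmin S4 S5)))).
    pose proof (Rmin_l S2 (Rmin S3 (Rmin S4 S5))).
    pose proof (Rmin_r S2 (Rmin S3 (Rmin S4 S5))).
    pose proof (Rmin_l S3 (Rmin S4 S5)). pose proof (Rmin_r S3 (Rmin S4 S5)).
    pose proof (Rmin_l S4 S5). pose proof (Rmin_r S4 S5). lra. }
  exists (S - 2). split; [lra|split; [lra|]]. intros s t Hs.
  assert (Hest : Rabs (Uss s t - Utt s t) <= 8 * d * (1 + / gamma) /\
                 Rabs (Ust s t) <= 8 * d * (1 + / gamma)).
  { apply (hessian_estimate (fun s _ => s < S0)
      (fun x y => U x y + (ln (- s) + ln k0 / 2)) Us Ut Uss Ust Utt s t (ln 2)).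
    - apply open2_half_plane.
    - now apply C2_jet_plus_const.
    - apply ln2_pos.
    - lra.
    - intros; apply half_plane_disc; trivial; lra.
    - lra.
    - intros y. apply HU; [lra|]. apply unit_disc_bound. lra.
    - intros x y Hx. unfold logpolar. pose proof (unit_disc_bound s x y Hx) as Hxy.
      rewrite !Heq by lra.
      specialize (HH s t x y ltac:(lra) Hx).
      set (s' := s + exp x * cos y) in *. set (t' := t + exp x * sin y) in *.
      destruct (HF s' t' ltac:(lra)) as [HE _].
      specialize (HK s t ltac:(lra)).
      assert (Hx1 : exp x <= exp (gamma * x)).
      { destruct (Req_dec x (gamma * x)) as [E|E]; [rewrite <- E; lra|].
        left; apply exp_increasing. nra. }
      assert (Hosc : Rabs (exp (2 * U s' t') - exp (2 * U s t)) <= 4 * e * exp x).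
      (* [Y] is [e^(2 U)] along the ray from the centre to [(s', t')]. Its derivative is at most
         [2 e] times [|Us| + |Ut| <= 2], whence the factor 4. *)
      { pose (Y := fun r => exp (2 * U (s + r * cos y) (t + r * sin y))).
        pose (Y' := fun r => 2 * exp (2 * U (s + r * cos y) (t + r * sin y))
          * (Us (s + r * cos y) (t + r * sin y) * cos y
             + Ut (s + r * cos y) (t + r * sin y) * sin y)).
        assert (Hr : forall r, 0 <= r <= exp x -> s + r * cos y <= s + 1).
        { intros r Hr. assert (exp x <= 1).
          { rewrite <- exp_0. destruct Hx as [Hx| ->]; [left; now apply exp_increasing|lra]. }
          pose proof (COS_bound y). nra. }
        assert (HY : forall r, 0 <= r <= exp x -> is_derive Y r (Y' r)).
        { intros r Hrr. specialize (Hr r Hrr). evar_last.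
          - apply (is_derive_comp exp (fun r => 2 * U (s + r * cos y) (t + r * sin y))).
            + apply is_derive_exp.
            + apply (is_derive_scal (fun r => U (s + r * cos y) (t + r * sin y))).
              apply (C1_jet_chain (fun s _ => s < S0) U Us Ut
                (fun r => s + r * cos y) (fun r => t + r * sin y) r (cos y) (sin y)).
              * apply open2_half_plane.
              * apply J.
              * lra.
              * auto_derive; trivial; ring.
              * auto_derive; trivial; ring.
          - unfold Y', scal; simpl; unfold mult; simpl. ring. }
        pose proof (exp_pos x) as Hex.
        destruct (MVT_gen Y 0 (exp x) Y') as (c & Hc & Ec).
        - rewrite Rmin_left, Rmax_right by lra. intros r Hrr. apply HY; lra.
        - rewrite Rmin_left, Rmax_right by lra. intros r Hrr.
          apply continuity_pt_is_derive with (Y' r), HY; lra.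
        - rewrite Rmin_left, Rmax_right in Hc by lra.
          replace (exp (2 * U s' t') - exp (2 * U s t)) with (Y (exp x) - Y 0)
            by (unfold Y, s', t'; now rewrite !Rmult_0_l, !Rplus_0_r).
          rewrite Ec, Rminus_0_r, Rabs_mult, (Rabs_pos_eq (exp x)) by lra.
          apply Rmult_le_compat_r; [lra|]. unfold Y'.
          specialize (Hr c Hc).
          destruct (HF (s + c * cos y) (t + c * sin y) ltac:(lra)) as [HE' _].
          destruct (HG (s + c * cos y) (t + c * sin y) ltac:(lra)) as [G1 G2].
          set (p := Us (s + c * cos y) (t + c * sin y)) in *.
          set (q := Ut (s + c * cos y) (t + c * sin y)) in *.
          rewrite Rabs_mult.
          replace (4 * e) with (2 * e * 2) by ring.
          apply Rmult_le_compat; try apply Rabs_pos.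
          + pose proof (exp_pos (2 * U (s + c * cos y) (t + c * sin y))).
            rewrite Rabs_pos_eq; lra.
          + apply Rle_trans with (1 := Rabs_triang _ _).
            rewrite (Rmult_comm p), (Rmult_comm q).
            pose proof (Rabs_cos_mult_le y p G1). pose proof (Rabs_sin_mult_le y q G2).
            lra. }
      replace (k s' t' * exp (2 * U s' t') - k s t * exp (2 * U s t))
        with ((k s' t' - k s t) * exp (2 * U s' t')
              + k s t * (exp (2 * U s' t') - exp (2 * U s t))) by ring.
      apply Rle_trans with (1 := Rabs_triang _ _). rewrite !Rabs_mult.
      rewrite (Rabs_pos_eq (exp (2 * U s' t'))) by (left; apply exp_pos).
      assert (Q1 : Rabs (k s' t' - k s t) * exp (2 * U s' t')
                   <= Rabs M * exp (gamma * x) * e).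
      { apply Rmult_le_compat; [apply Rabs_pos|left; apply exp_pos| |easy].
        apply Rle_trans with (1 := HH). apply Rmult_le_compat_r; [left; apply exp_pos|].
        apply Rle_abs. }
      assert (Q2 : Rabs (k s t) * Rabs (exp (2 * U s' t') - exp (2 * U s t))
                   <= (k0 + 1) * (4 * e * exp (gamma * x))).
      { apply Rmult_le_compat; try apply Rabs_pos.
        - apply Rabs_lt_between in HK. apply Rabs_le. lra.
        - apply Rle_trans with (1 := Hosc). apply Rmult_le_compat_l; lra. }
      rewrite <- He1. pose proof (exp_pos (gamma * x)).
      assert (0 < e * exp (gamma * x)) by (now apply Rmult_lt_0_compat). lra. }
  destruct Hest as [E1 E2].
  (* The equation bounds the trace [Uss + Utt]; half-sums with [Uss - Utt] give the two diagonal
     entries. *)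
  destruct (HF s t ltac:(lra)) as [_ E3]. rewrite <- Heq in E3 by lra.
  assert (e <= d).
  { rewrite <- He1. rewrite <- (Rmult_1_r e) at 1. apply Rmult_le_compat_l; lra. }
  assert (d <= eps).
  { apply Rle_trans with (2 := Hd2).
    assert (0 < d * / gamma) by (now apply Rmult_lt_0_compat). lra. }
  apply Rabs_le_between in E1. apply Rabs_le_between in E3.
  split; [|split; [lra|]]; apply Rabs_le; lra.
Qed.

End Growth.

End Asymptotics.

(** * Wirtinger derivatives in polar coordinates *)

Lemma open2_of_open (D : C -> Prop) : open D -> open2 (fun x y => D (x, y)).
Proof.
  intros HD x y H. apply locally_2d_locally.
  apply filter_imp with (2 := HD (x, y) H). now intros [u v].
Qed.

(** [ex_diff_n] delivers the two mixed derivatives separately; Schwarz' theorem identifies them, as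
    the single [fxy] of a jet demands. *)
Lemma C2_on_jet (D : C -> Prop) (f : C -> R) :
  open D -> C2_on D f ->
  exists fx fy fxx fxy fyy,
    C2_jet (fun x y => D (x, y)) (fun x y => f (x, y)) fx fy fxx fxy fyy.
Proof.
  intros HD Hf. pose proof (open2_of_open D HD) as HD2.
  set (g := fun x y => f (x, y)).
  exists (fun x y => Derive (fun t => g t y) x), (fun x y => Derive (fun t => g x t) y),
    (fun x y => Derive (fun u => Derive (fun t => g t y) u) x),
    (fun x y => Derive (fun v => Derive (fun t => g t v) x) y),
    (fun x y => Derive (fun v => Derive (fun t => g x t) v) y).
  assert (Hg : forall x y, D (x, y) -> ex_diff_n g 2 x y) by (intros; now apply (Hf (x, y))).
  assert (Hmix : forall x y, D (x, y) ->
    Derive (fun u => Derive (fun t => g u t) y) x = Derive (fun v => Derive (fun t => g t v) x) y).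
  { intros x y H. apply Schwarz.
    - destruct (HD2 x y H) as [d Hd]. exists d. intros u v Hu Hv.
      destruct (Hg u v (Hd u v Hu Hv)) as (_ & E1 & E2 & (_ & _ & E4 & _) & (_ & E5 & _)).
      now repeat split.
    - apply (Hg x y H).
    - apply (Hg x y H). }
  split; [|split]; intros x y H;
    destruct (Hg x y H) as (_ & E1 & E2 & (C1 & X1 & X2 & (XX1 & _) & (XX2 & _)) &
      (C2 & Y1 & Y2 & (YY1 & _) & (YY2 & _))).
  - split; [|split; [|split]]; trivial; now apply Derive_correct.
  - split; [|split; [|split]]; trivial.
    + apply (Derive_correct (fun u => Derive (fun t => g t y) u)). exact X1.
    + apply (Derive_correct (fun v => Derive (fun t => g t v) x)). exact X2.
  - split; [|split; [|split]]; trivial.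
    + rewrite <- Hmix by easy.
      apply (Derive_correct (fun u => Derive (fun t => g u t) y)). exact Y1.
    + apply (Derive_correct (fun v => Derive (fun t => g x t) v)). exact Y2.
Qed.

Lemma C2_jet_ln D f fx fy fxx fxy fyy :
  open2 D -> C2_jet D f fx fy fxx fxy fyy -> (forall x y, D x y -> 0 < f x y) ->
  C2_jet D (fun x y => ln (f x y)) (fun x y => / f x y * fx x y) (fun x y => / f x y * fy x y)
    (fun x y => / f x y * fxx x y - (/ f x y * fx x y) * (/ f x y * fx x y))
    (fun x y => / f x y * fxy x y - (/ f x y * fx x y) * (/ f x y * fy x y))
    (fun x y => / f x y * fyy x y - (/ f x y * fy x y) * (/ f x y * fy x y)).
Proof.
  intros HD (J1 & J2 & J3) Hpos.
  assert (JI : C1_jet D (fun x y => / f x y) (fun x y => - / f x y ^ 2 * fx x y)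
    (fun x y => - / f x y ^ 2 * fy x y)).
  { apply (C1_jet_comp D f fx fy Rinv (fun v => - / v ^ 2)); trivial.
    intros x y H. specialize (Hpos x y H). split.
    - auto_derive; [lra|]. field. lra.
    - apply continuity_pt_is_derive with (2 / f x y ^ 3).
      auto_derive; [nra|]. field. lra. }
  split; [|split].
  - apply (C1_jet_comp D f fx fy ln Rinv); trivial.
    intros x y H. specialize (Hpos x y H). split.
    + auto_derive; [lra|]. field. lra.
    + apply continuity_pt_is_derive with (- / f x y ^ 2).
      auto_derive; [lra|]. field. lra.
  - apply C1_jet_ext with (4 := C1_jet_mult _ _ _ _ _ _ _ HD JI J2); intros; try reflexivity;
    rewrite <- pow_inv; ring.
  - apply C1_jet_ext with (4 := C1_jet_mult _ _ _ _ _ _ _ HD JI J3); intros; try reflexivity;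
    rewrite <- pow_inv; ring.
Qed.

Lemma open2_locally_x D x y : open2 D -> D x y -> locally x (fun t => D t y).
Proof. intros HD H. apply (locally_2d_1d_const_y D x y). now apply HD. Qed.

Lemma open2_locally_y D x y : open2 D -> D x y -> locally y (fun t => D x t).
Proof. intros HD H. apply (locally_2d_1d_const_x D x y). now apply HD. Qed.

Lemma laplacian_jet (D : C -> Prop) (u : C -> R) ux uy uxx uxy uyy z :
  open D -> C2_jet (fun x y => D (x, y)) (fun x y => u (x, y)) ux uy uxx uxy uyy ->
  D z -> laplacian u z = uxx (Re z) (Im z) + uyy (Re z) (Im z).
Proof.
  intros HD (J1 & J2 & J3) Hz. destruct z as [x y]. simpl.
  pose proof (open2_of_open D HD) as HD2.
  unfold laplacian; simpl. f_equal.
  - rewrite (Derive_ext_loc _ (fun t => ux t y)).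
    + apply is_derive_unique. now apply J2.
    + apply filter_imp with (2 := open2_locally_x _ x y HD2 Hz).
      intros t Ht. apply is_derive_unique. now apply J1.
  - rewrite (Derive_ext_loc _ (fun t => uy x t)).
    + apply is_derive_unique. now apply J3.
    + apply filter_imp with (2 := open2_locally_y _ x y HD2 Hz).
      intros t Ht. apply is_derive_unique. now apply J1.
Qed.

Lemma wirtinger_components f z :
  wirtinger f z = ((fst (Cderive_x f z) + snd (Cderive_y f z)) / 2,
                   (snd (Cderive_x f z) - fst (Cderive_y f z)) / 2).
Proof. apply injective_projections; simpl; field. Qed.

Lemma wirtinger_bar_components f z :
  wirtinger_bar f z = ((fst (Cderive_x f z) - snd (Cderive_y f z)) / 2,
                       (snd (Cderive_x f z) + fst (Cderive_y f z)) / 2).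
Proof. apply injective_projections; simpl; field. Qed.

Section RealWirtinger.

Context (D : C -> Prop) (f : C -> R) (fx fy fxx fxy fyy : R -> R -> R) (HD : open D)
  (J : C2_jet (fun x y => D (x, y)) (fun x y => f (x, y)) fx fy fxx fxy fyy).

Lemma wirtinger_real x y : D (x, y) ->
  wirtinger (fun z => RtoC (f z)) (x, y) = (fx x y / 2, - fy x y / 2).
Proof.
  intros H. destruct J as (J1 & _). destruct (J1 x y H) as (E1 & E2 & _).
  assert (D1 : Derive (fun t => f (t, y)) x = fx x y) by now apply is_derive_unique.
  assert (D2 : Derive (fun t => f (x, t)) y = fy x y) by now apply is_derive_unique.
  rewrite wirtinger_components.
  change (((Derive (fun t => f (t, y)) x + Derive (fun _ => 0) y) / 2,
    (Derive (fun _ => 0) x - Derive (fun t => f (x, t)) y) / 2)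
    = (fx x y / 2, - fy x y / 2)).
  rewrite !Derive_const, D1, D2.
  f_equal; field.
Qed.

Lemma Cderive_wirtinger_real x y : D (x, y) ->
  Cderive_x (wirtinger (fun z => RtoC (f z))) (x, y) = (fxx x y / 2, - fxy x y / 2) /\
  Cderive_y (wirtinger (fun z => RtoC (f z))) (x, y) = (fxy x y / 2, - fyy x y / 2).
Proof.
  intros H. pose proof (open2_of_open D HD) as HD2. destruct J as (J1 & J2 & J3).
  destruct (J2 x y H) as (X1 & X2 & _). destruct (J3 x y H) as (Y1 & Y2 & _).
  assert (Hd : forall (g h : R -> R) t l c, locally t (fun v => g v = c * h v) ->
    is_derive h t l -> Derive g t = c * l).
  { intros g h t l c Hl Hh. rewrite (Derive_ext_loc _ _ _ Hl).
    apply is_derive_unique. now apply is_derive_scal. }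
  split; unfold Cderive_x, Cderive_y;
    change (Re (x, y)) with x; change (Im (x, y)) with y; f_equal.
  - rewrite (Hd _ (fun t => fx t y) x (fxx x y) (/ 2)); trivial; [field|].
    apply filter_imp with (2 := open2_locally_x _ x y HD2 H). intros t Ht.
    rewrite wirtinger_real by easy. simpl. field.
  - rewrite (Hd _ (fun t => fy t y) x (fxy x y) (- / 2)); trivial; [field|].
    apply filter_imp with (2 := open2_locally_x _ x y HD2 H). intros t Ht.
    rewrite wirtinger_real by easy. simpl. field.
  - rewrite (Hd _ (fun t => fx x t) y (fxy x y) (/ 2)); trivial; [field|].
    apply filter_imp with (2 := open2_locally_y _ x y HD2 H). intros t Ht.
    rewrite wirtinger_real by easy. simpl. field.
  - rewrite (Hd _ (fun t => fy x t) y (fyy x y) (- / 2)); trivial; [field|].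
    apply filter_imp with (2 := open2_locally_y _ x y HD2 H). intros t Ht.
    rewrite wirtinger_real by easy. simpl. field.
Qed.

Lemma wirtinger_wirtinger_real x y : D (x, y) ->
  wirtinger (wirtinger (fun z => RtoC (f z))) (x, y)
  = ((fxx x y - fyy x y) / 4, - fxy x y / 2).
Proof.
  intros H. destruct (Cderive_wirtinger_real x y H) as [E1 E2].
  rewrite wirtinger_components, E1, E2; simpl. f_equal; field.
Qed.

Lemma wirtinger_bar_wirtinger_real x y : D (x, y) ->
  wirtinger_bar (wirtinger (fun z => RtoC (f z))) (x, y)
  = ((fxx x y + fyy x y) / 4, 0).
Proof.
  intros H. destruct (Cderive_wirtinger_real x y H) as [E1 E2].
  rewrite wirtinger_bar_components, E1, E2; simpl. f_equal; field.
Qed.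

End RealWirtinger.

(** * Polar coordinates at the singularity *)

Definition polar (p : C) (s t : R) : C :=
  (fst p + exp s * cos t, snd p + exp s * sin t).

Lemma Cmod_polar p s t : Cmod (polar p s t - p) = exp s.
Proof.
  unfold Cmod; simpl.
  replace ((fst p + exp s * cos t + - fst p) * ((fst p + exp s * cos t + - fst p) * 1)
    + (snd p + exp s * sin t + - snd p) * ((snd p + exp s * sin t + - snd p) * 1))
    with (exp s * exp s) by ring [(sin_sq t)].
  apply sqrt_square. left; apply exp_pos.
Qed.

Lemma polar_ball (p : C) s t (delta : posreal) : exp s < delta ->
  ball p delta (polar p s t).
Proof.
  intros H. pose proof (exp_pos s). split.
  - change (Rabs (fst p + exp s * cos t - fst p) < delta).
    replace (fst p + exp s * cos t - fst p) with (cos t * exp s) by ring.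
    rewrite Rabs_mult, (Rabs_pos_eq (exp s)) by lra.
    assert (Rabs (cos t) <= 1) by (apply Rabs_le, COS_bound). nra.
  - change (Rabs (snd p + exp s * sin t - snd p) < delta).
    replace (snd p + exp s * sin t - snd p) with (sin t * exp s) by ring.
    rewrite Rabs_mult, (Rabs_pos_eq (exp s)) by lra.
    assert (Rabs (sin t) <= 1) by (apply Rabs_le, SIN_bound). nra.
Qed.

Lemma polar_neq p s t : polar p s t <> p.
Proof.
  intros E. pose proof (Cmod_polar p s t) as H. rewrite E in H.
  replace (p - p)%C with (RtoC 0) in H by ring. rewrite Cmod_0 in H.
  pose proof (exp_pos s). lra.
Qed.

Lemma cos_sin_surj x y : x * x + y * y = 1 -> exists t, cos t = x /\ sin t = y.
Proof.
  intros H. assert (Hx : -1 <= x <= 1) by nra.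
  assert (Hs : sqrt (1 - Rsqr x) = Rabs y).
  { unfold Rsqr. replace (1 - x * x) with (Rsqr y) by (unfold Rsqr; lra).
    apply sqrt_Rsqr_abs. }
  destruct (Rle_or_lt 0 y) as [Hy|Hy].
  - exists (acos x). rewrite cos_acos, sin_acos, Hs by easy.
    split; [easy|]. now apply Rabs_pos_eq.
  - exists (- acos x). rewrite cos_neg, sin_neg, cos_acos, sin_acos, Hs by easy.
    split; [easy|]. rewrite Rabs_left by easy. ring.
Qed.

Lemma Cmod_minus_pos p z : z <> p -> 0 < Cmod (z - p).
Proof.
  intros Hz. apply Cmod_gt_0. intros E. apply Hz.
  replace z with (z - p + p)%C by ring. rewrite E. ring.
Qed.

Lemma polar_surj p z : z <> p -> exists t, z = polar p (ln (Cmod (z - p))) t.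
Proof.
  intros Hz. pose proof (Cmod_minus_pos p z Hz) as Hm.
  set (r := Cmod (z - p)) in *.
  assert (Hr : r * r = (fst z - fst p) * (fst z - fst p) + (snd z - snd p) * (snd z - snd p)).
  { unfold r, Cmod. rewrite sqrt_sqrt; [simpl; ring|].
    apply Rplus_le_le_0_compat; apply pow2_ge_0. }
  destruct (cos_sin_surj ((fst z - fst p) / r) ((snd z - snd p) / r)) as (t & Hc & Hs).
  { apply Rmult_eq_reg_l with (r * r); [|nra]. rewrite Hr at 2. field. lra. }
  exists t. unfold polar. rewrite exp_ln, Hc, Hs by easy.
  apply injective_projections; simpl; field; lra.
Qed.

(* The filter [|z - p| -> 0], uniformly in the argument, in the coordinates of [polar]. *)
Definition polar_end (P : R * R -> Prop) : Prop :=
  exists S, forall s t, s < S -> P (s, t).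

Global Instance polar_end_filter : Filter polar_end.
Proof.
  constructor.
  - exists 0. easy.
  - intros P Q [S HS] [T HT]. exists (Rmin S T). intros s t Hs. split.
    + apply HS. apply Rlt_le_trans with (1 := Hs), Rmin_l.
    + apply HT. apply Rlt_le_trans with (1 := Hs), Rmin_r.
  - intros P Q H [S HS]. exists S. intros s t Hs. now apply H, HS.
Qed.

Lemma locally'_polar (p : C) (P : C -> Prop) :
  polar_end (fun st => P (polar p (fst st) (snd st))) -> locally' p P.
Proof.
  (* Balls of [C] are squares in the two coordinates, so the modulus can exceed the radius by a
     factor [sqrt 2]; the shift from [S] to [S - 1] gains a factor [e >= 2]. *)
  intros [S HS]. exists (mkposreal _ (exp_pos (S - 1))). intros z Hz Hne.
  destruct (polar_surj p z Hne) as [t Ht]. rewrite Ht. apply (HS (ln (Cmod (z - p))) t).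
  apply exp_lt_inv.
  pose proof (Cmod_minus_pos p z Hne) as Hm.
  rewrite exp_ln by easy.
  destruct Hz as [H1 H2]. change (Rabs (fst z - fst p) < exp (S - 1)) in H1.
  change (Rabs (snd z - snd p) < exp (S - 1)) in H2.
  assert (Hmod : Cmod (z - p) <= sqrt 2 * Rmax (Rabs (fst z - fst p)) (Rabs (snd z - snd p))).
  { apply (Cmod_2Rmax (z - p)). }
  assert (Hmax : Rmax (Rabs (fst z - fst p)) (Rabs (snd z - snd p)) < exp (S - 1)).
  { now apply Rmax_lub_lt. }
  apply Rle_lt_trans with (1 := Hmod).
  assert (Hs2 : 0 < sqrt 2 <= 2).
  { split; [apply sqrt_lt_R0; lra|]. rewrite <- (sqrt_square 2) at 2 by lra.
    apply sqrt_le_1; lra. }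
  replace S with (1 + (S - 1)) by ring. rewrite exp_plus.
  pose proof (exp_ineq1_le 1). pose proof (exp_pos (S - 1)).
  apply Rlt_le_trans with (sqrt 2 * exp (S - 1)).
  - apply Rmult_lt_compat_l; lra.
  - apply Rmult_le_compat_r; lra.
Qed.

Lemma filterlim_polar (p : C) (f : C -> C) (l : C) (re im : R * R -> R) :
  polar_end (fun st => f (polar p (fst st) (snd st)) = (re st, im st)) ->
  filterlim re polar_end (locally (fst l)) -> filterlim im polar_end (locally (snd l)) ->
  filterlim f (locally' p) (locally l).
Proof.
  intros Hf Hre Him. apply filterlim_locally. intros eps.
  apply locally'_polar.
  pose proof (proj1 (filterlim_locally _ _) Hre eps) as H1.
  pose proof (proj1 (filterlim_locally _ _) Him eps) as H2.
  generalize (filter_and _ _ Hf (filter_and _ _ H1 H2)).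
  apply filter_imp. intros st (E & K1 & K2). rewrite E. now split.
Qed.

Lemma filterlim_polar_end_plus f g l m :
  filterlim f polar_end (locally l) -> filterlim g polar_end (locally m) ->
  filterlim (fun st => f st + g st) polar_end (locally (l + m)).
Proof.
  intros Hf Hg. apply (filterlim_comp_2 f g Rplus Hf Hg).
  apply (filterlim_plus (V := R_NormedModule)).
Qed.

Lemma filterlim_polar_end_mult f g l m :
  filterlim f polar_end (locally l) -> filterlim g polar_end (locally m) ->
  filterlim (fun st => f st * g st) polar_end (locally (l * m)).
Proof.
  intros Hf Hg. apply (filterlim_comp_2 f g Rmult Hf Hg).
  apply (filterlim_mult (K := R_AbsRing)).
Qed.

Lemma filterlim_polar_end_small (f : R -> R -> R) l :
  (forall eps, 0 < eps -> exists S, forall s t, s < S -> Rabs (f s t - l) <= eps) ->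
  filterlim (fun st => f (fst st) (snd st)) polar_end (locally l).
Proof.
  intros H. apply filterlim_locally. intros eps. pose proof (cond_pos eps) as He.
  destruct (H (eps / 2)) as [S HS]; [lra|].
  exists S. intros s t Hs. specialize (HS s t Hs). simpl.
  change (Rabs (f s t - l) < eps). lra.
Qed.

Lemma lipschitz_of_derive (f f' : R -> R) x y :
  (forall c, is_derive f c (f' c)) ->
  (forall c, Rmin x y <= c <= Rmax x y -> Rabs (f' c) <= 1) ->
  Rabs (f y - f x) <= Rabs (y - x).
Proof.
  intros Hd Hb. destruct (MVT_gen f x y f') as (c & Hc & E).
  - intros; apply Hd.
  - intros z _. apply continuity_pt_is_derive with (f' z), Hd.
  - rewrite E, Rabs_mult. specialize (Hb c Hc).
    pose proof (Rabs_pos (y - x)). pose proof (Rabs_pos (f' c)). nra.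
Qed.

Lemma Rabs_mult_minus_le a b c d r :
  Rabs b <= 1 -> Rabs c <= 1 -> Rabs (a - c) <= r -> Rabs (b - d) <= r ->
  Rabs (a * b - c * d) <= 2 * r.
Proof.
  intros Hb Hc H1 H2.
  replace (a * b - c * d) with ((a - c) * b + c * (b - d)) by ring.
  apply Rle_trans with (1 := Rabs_triang _ _). rewrite !Rabs_mult.
  pose proof (Rabs_pos (a - c)). pose proof (Rabs_pos (b - d)).
  pose proof (Rabs_pos b). pose proof (Rabs_pos c). nra.
Qed.

(** The exponential is Lipschitz on the left half-plane, and [s0 <= -1] keeps the unit disc there.
    Each coordinate moves by at most [2 e^s]; another factor 2 covers [sqrt 2]. *)
Lemma polar_dist_le p s0 t0 s t : s0 <= -1 -> s <= 0 ->
  Cmod (polar p (s0 + exp s * cos t) (t0 + exp s * sin t) - polar p s0 t0) <= 4 * exp s.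
Proof.
  intros Hs0 Hs. pose proof (unit_disc_bound s0 s t Hs) as Hb.
  set (s1 := s0 + exp s * cos t) in *. set (t1 := t0 + exp s * sin t) in *.
  pose proof (exp_pos s) as He.
  assert (Hds : Rabs (s1 - s0) <= exp s).
  { replace (s1 - s0) with (cos t * exp s) by (unfold s1; ring).
    rewrite Rabs_mult, (Rabs_pos_eq (exp s)) by lra.
    assert (Rabs (cos t) <= 1) by (apply Rabs_le, COS_bound). nra. }
  assert (Hdt : Rabs (t1 - t0) <= exp s).
  { replace (t1 - t0) with (sin t * exp s) by (unfold t1; ring).
    rewrite Rabs_mult, (Rabs_pos_eq (exp s)) by lra.
    assert (Rabs (sin t) <= 1) by (apply Rabs_le, SIN_bound). nra. }
  assert (Hexp1 : forall c, c <= 0 -> Rabs (exp c) <= 1).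
  { intros c Hc. rewrite Rabs_pos_eq by (left; apply exp_pos). rewrite <- exp_0.
    destruct Hc as [Hc| ->]; [left; now apply exp_increasing|lra]. }
  assert (Hex : Rabs (exp s1 - exp s0) <= exp s).
  { apply Rle_trans with (2 := Hds). apply (lipschitz_of_derive exp exp).
    - intros c. apply is_derive_exp.
    - intros c [_ Hc]. apply Hexp1. apply Rle_trans with (1 := Hc).
      apply Rmax_lub; lra. }
  assert (Hcos : Rabs (cos t1 - cos t0) <= exp s).
  { apply Rle_trans with (2 := Hdt). apply (lipschitz_of_derive cos (fun c => - sin c)).
    - apply is_derive_cos.
    - intros c _. rewrite Rabs_Ropp. apply Rabs_le, SIN_bound. }
  assert (Hsin : Rabs (sin t1 - sin t0) <= exp s).
  { apply Rle_trans with (2 := Hdt). apply (lipschitz_of_derive sin cos).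
    - apply is_derive_sin.
    - intros c _. apply Rabs_le, COS_bound. }
  assert (K1 : Rabs (exp s1 * cos t1 - exp s0 * cos t0) <= 2 * exp s).
  { apply Rabs_mult_minus_le; trivial; [apply Rabs_le, COS_bound|apply Hexp1; lra]. }
  assert (K2 : Rabs (exp s1 * sin t1 - exp s0 * sin t0) <= 2 * exp s).
  { apply Rabs_mult_minus_le; trivial; [apply Rabs_le, SIN_bound|apply Hexp1; lra]. }
  apply Rle_trans with (1 := Cmod_2Rmax _).
  assert (Hs2 : 0 <= sqrt 2 <= 2).
  { split; [apply sqrt_pos|]. rewrite <- (sqrt_square 2) at 2 by lra.
    apply sqrt_le_1; lra. }
  assert (Hm : Rmax (Rabs (exp s1 * cos t1 - exp s0 * cos t0))
    (Rabs (exp s1 * sin t1 - exp s0 * sin t0)) <= 2 * exp s) by now apply Rmax_lub.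
  replace (fst (polar p s1 t1 - polar p s0 t0)%C) with (exp s1 * cos t1 - exp s0 * cos t0)
    by (simpl; ring).
  replace (snd (polar p s1 t1 - polar p s0 t0)%C) with (exp s1 * sin t1 - exp s0 * sin t0)
    by (simpl; ring).
  replace (4 * exp s) with (2 * (2 * exp s)) by ring.
  apply Rmult_le_compat; trivial; try lra.
  apply Rle_trans with (2 := Rmax_l _ _). apply Rabs_pos.
Qed.

(** Order 1 says that the supremum over the circle is at least [(1 - d) (- s)]. A point within 1 of
    it has [u + s >= d s - 1]; one half of [c s] pays for [d s], the other for the 1. *)
Lemma has_order_one_growth (u : C -> R) p c : has_order u p 1 -> 0 < c ->
  exists S, forall s, s < S -> exists t, c * s <= u (polar p s t) + s.
Proof.
  intros Ho Hc. set (d := Rmin (c / 2) (1 / 2)).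
  assert (Hd0 : 0 < d) by (apply Rmin_pos; lra).
  assert (Hd1 : d <= c / 2) by apply Rmin_l.
  assert (Hd2 : d <= 1 / 2) by apply Rmin_r.
  destruct (proj1 (filterlim_locally _ _) Ho (mkposreal d Hd0)) as [delta Hdelta].
  destruct (exp_small delta (cond_pos delta)) as (S & HS & HSd).
  set (S' := Rmin S (- (2 / c))).
  assert (S' <= S /\ S' <= - (2 / c)) as [L1 L2] by (split; [apply Rmin_l|apply Rmin_r]).
  exists S'. intros s Hs. pose proof (exp_pos s) as He.
  assert (Hb : ball 0 delta (exp s)).
  { change (Rabs (exp s - 0) < delta). rewrite Rminus_0_r, Rabs_pos_eq by lra.
    apply HSd. lra. }
  specialize (Hdelta (exp s) Hb He).
  set (E := fun t => exists z, Cmod (z - p) = exp s /\ t = u z) in *.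
  change (Rabs (real (Lub_Rbar E) / ln (1 / exp s) - 1) < d) in Hdelta.
  replace (ln (1 / exp s)) with (- s) in Hdelta
    by (unfold Rdiv; rewrite Rmult_1_l, ln_Rinv, ln_exp by lra; reflexivity).
  apply Rabs_lt_between in Hdelta. destruct Hdelta as [Hl _].
  assert (Hlub : (1 - d) * - s <= real (Lub_Rbar E)).
  { apply Rmult_le_reg_r with (/ - s); [apply Rinv_0_lt_compat; lra|].
    replace ((1 - d) * - s * / - s) with (1 - d) by (field; lra).
    unfold Rdiv in Hl. lra. }
  assert (Hpos : 0 < real (Lub_Rbar E)).
  { apply Rlt_le_trans with (2 := Hlub). apply Rmult_lt_0_compat; lra. }
  pose proof (Lub_Rbar_correct E) as [_ Hmin].
  (* An infinite supremum would have been sent to 0 by [real], against [Hpos]. *)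
  destruct (Lub_Rbar E) as [l| |]; simpl in Hpos, Hlub; try lra.
  assert (Hex : exists z, Cmod (z - p) = exp s /\ l - 1 < u z).
  { apply Classical_Prop.NNPP. intros Hno.
    assert (Hub : is_ub_Rbar E (Finite (l - 1))).
    { intros v (z & Hz & ->). simpl. apply Rnot_lt_le. intros Hlt. apply Hno.
      now exists z. }
    specialize (Hmin _ Hub). simpl in Hmin. lra. }
  destruct Hex as (z & Hz & Hu).
  destruct (polar_surj p z) as [t Ht].
  { intros ->. replace (p - p)%C with (RtoC 0) in Hz by ring. rewrite Cmod_0 in Hz. lra. }
  rewrite Hz, ln_exp in Ht. exists t. rewrite <- Ht.
  assert (c / 2 * s <= - 1).
  { replace (-1) with (c / 2 * (- (2 / c))) by (field; lra).
    apply Rmult_le_compat_l; lra. }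
  assert (d * - s <= c / 2 * - s) by (apply Rmult_le_compat_r; lra). lra.
Qed.

Lemma C2_jet_plus_s D f fs ft fss fst' ftt :
  C2_jet D f fs ft fss fst' ftt ->
  C2_jet D (fun s t => f s t + s) (fun s t => fs s t + 1) ft fss fst' ftt.
Proof.
  intros (H1 & H2 & H3).
  assert (Hs : C1_jet D (fun s _ => s) (fun _ _ => 1) (fun _ _ => 0)).
  { intros x y _. split; [|split; [|split]]; try apply continuity_2d_pt_const.
    - apply (is_derive_id (K := R_AbsRing)).
    - apply (is_derive_const (K := R_AbsRing) (V := R_NormedModule)). }
  split; [|split; trivial].
  - apply C1_jet_ext with (4 := C1_jet_plus _ _ _ _ _ _ _ H1 Hs); intros; ring.
  - apply C1_jet_ext with (4 := C1_jet_plus _ _ _ _ _ _ _ H2 (C1_jet_const D 1));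
    intros; ring.
Qed.

(** Stated for the derivatives of [u] in polar coordinates rather than of [U]; since [U] is [u + s],
    the limit 0 of its [s]-derivative becomes -1 here. *)
Lemma singularity_limits (Omega : C -> Prop) (u kappa : C -> R) (p : C)
    (ux uy uxx uxy uyy : R -> R -> R) :
  open Omega -> locally' p Omega ->
  C2_jet (fun x y => Omega (x, y)) (fun x y => u (x, y)) ux uy uxx uxy uyy ->
  (forall x y, Omega (x, y) -> uxx x y + uyy x y = - kappa (x, y) * exp (2 * u (x, y))) ->
  holder_continuous_on (fun z => Omega z \/ z = p) kappa -> kappa p < 0 ->
  has_order u p 1 ->
  filterlim (fun st => - fst st * exp (u (polar p (fst st) (snd st)) + fst st))
    polar_end (locally (/ sqrt (- kappa p))) /\
  filterlim (fun st => lp_s (fst p) (snd p) ux uy (fst st) (snd st))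
    polar_end (locally (-1)) /\
  filterlim (fun st => lp_t (fst p) (snd p) ux uy (fst st) (snd st))
    polar_end (locally 0) /\
  filterlim (fun st => lp_ss (fst p) (snd p) ux uy uxx uxy uyy (fst st) (snd st))
    polar_end (locally 0) /\
  filterlim (fun st => lp_st (fst p) (snd p) ux uy uxx uxy uyy (fst st) (snd st))
    polar_end (locally 0) /\
  filterlim (fun st => lp_tt (fst p) (snd p) ux uy uxx uxy uyy (fst st) (snd st))
    polar_end (locally 0).
Proof.
  intros Hop Hloc J Heq (gamma & M & Hgamma & Hhol) Hneg Horder.
  pose proof (open2_of_open Omega Hop) as HD2.
  destruct Hloc as [delta Hdelta].
  destruct (exp_small delta (cond_pos delta)) as (S0 & HS0 & HSd).
  assert (Hdom : forall s t, s < S0 -> Omega (polar p s t)).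
  { intros s t Hs. apply Hdelta; [|apply polar_neq].
    apply polar_ball. now apply HSd. }
  (* The summand [s] is the logarithm of the modulus of the derivative of [e^(s + i t)], so [e^U] is
     the density of the pulled-back metric and the factor [e^(2 s)] of the Laplacian is absorbed. *)
  set (U := fun s t => u (polar p s t) + s).
  set (k := fun s t => - kappa (polar p s t)).
  set (k0 := - kappa p) in *.
  assert (JU : C2_jet (fun s _ => s < S0) U
    (fun s t => lp_s (fst p) (snd p) ux uy s t + 1) (lp_t (fst p) (snd p) ux uy)
    (lp_ss (fst p) (snd p) ux uy uxx uxy uyy) (lp_st (fst p) (snd p) ux uy uxx uxy uyy)
    (lp_tt (fst p) (snd p) ux uy uxx uxy uyy)).
  { apply (C2_jet_plus_s _ (logpolar (fst p) (snd p) (fun x y => u (x, y)))).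
    destruct (C2_jet_logpolar (fst p) (snd p) _ _ _ _ _ _ _ HD2 J) as (J1 & J2 & J3).
    assert (Hsub : forall s t, s < S0 ->
      logpolar_dom (fst p) (snd p) (fun x y => Omega (x, y)) s t)
      by (intros; now apply Hdom).
    split; [|split].
    - now apply C1_jet_sub with (2 := J1).
    - now apply C1_jet_sub with (2 := J2).
    - now apply C1_jet_sub with (2 := J3). }
  assert (HperU : periodic2 U).
  { apply (periodic2_logpolar (fst p) (snd p) (fun x y => u (x, y)) (fun s => s)). }
  assert (HeqU : forall s t, s < S0 ->
    lp_ss (fst p) (snd p) ux uy uxx uxy uyy s t + lp_tt (fst p) (snd p) ux uy uxx uxy uyy s t
    = k s t * exp (2 * U s t)).
  { intros s t Hs. rewrite lp_laplacian. unfold logpolar.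
    rewrite Heq by now apply Hdom. unfold k, U, polar.
    rewrite Rmult_plus_distr_l, exp_plus. ring. }
  assert (Hk0 : 0 < k0) by (unfold k0; lra).
  assert (Hk : forall eps, 0 < eps -> exists S, forall s t, s < S -> Rabs (k s t - k0) < eps).
  { intros eps He. pose proof (Rabs_pos M) as HM.
    assert (He' : 0 < eps / (Rabs M + 1)) by (apply Rdiv_lt_0_compat; lra).
    destruct (proj1 (is_lim_m_infty_eps _ _) (is_lim_exp_scal_m_infty gamma (proj1 Hgamma)) _ He')
      as [S HS].
    exists (Rmin S S0). intros s t Hs.
    assert (s < S) by (apply Rlt_le_trans with (1 := Hs), Rmin_l).
    assert (s < S0) by (apply Rlt_le_trans with (1 := Hs), Rmin_r).
    specialize (HS s ltac:(easy)).
    rewrite Rminus_0_r, Rabs_pos_eq in HS by (left; apply exp_pos).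
    unfold k, k0. replace (- kappa (polar p s t) - - kappa p)
      with (- (kappa (polar p s t) - kappa p)) by ring. rewrite Rabs_Ropp.
    assert (K := Hhol (polar p s t) p (or_introl (Hdom s t ltac:(easy))) (or_intror eq_refl)
      (polar_neq p s t)).
    rewrite Cmod_polar in K. unfold Rpower in K. rewrite ln_exp in K.
    apply Rle_lt_trans with (1 := K). pose proof (exp_pos (gamma * s)).
    apply Rmult_lt_compat_l with (r := Rabs M + 1) in HS; [|lra].
    replace ((Rabs M + 1) * (eps / (Rabs M + 1))) with eps in HS by (field; lra).
    pose proof (Rle_abs M). nra. }
  assert (HgrU : forall c, 0 < c -> exists S, forall s, s < S -> exists t, c * s <= U s t).
  { intros c Hc. now apply has_order_one_growth. }
  assert (HholU : exists S, forall s0 t0 s t, s0 < S -> s <= 0 ->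
    Rabs (k (s0 + exp s * cos t) (t0 + exp s * sin t) - k s0 t0)
    <= 4 * Rabs M * exp (gamma * s)).
  { exists (S0 - 1). intros s0 t0 s t Hs0 Hs.
    pose proof (unit_disc_bound s0 s t Hs) as Hb.
    pose proof (polar_dist_le p s0 t0 s t ltac:(lra) Hs) as Hdist.
    unfold k. set (z := polar p (s0 + exp s * cos t) (t0 + exp s * sin t)) in *.
    set (w := polar p s0 t0) in *.
    replace (- kappa z - - kappa w) with (- (kappa z - kappa w)) by ring. rewrite Rabs_Ropp.
    pose proof (Rabs_pos M) as HM. pose proof (exp_pos (gamma * s)) as Hep.
    (* Distinct points of the strip may have the same image, and the Holder hypothesis speaks of
       distinct points only. *)
    destruct (Classical_Prop.classic (z = w)) as [E|E].
    { rewrite E, Rminus_diag, Rabs_R0. nra. }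
    assert (Hz : Omega z) by (apply Hdom; lra).
    assert (Hw : Omega w) by (apply Hdom; lra).
    assert (K := Hhol z w (or_introl Hz) (or_introl Hw) E).
    apply Rle_trans with (1 := K).
    (* The factor [4^gamma] is at most 4 because [gamma <= 1]. *)
    assert (Hpw : Rpower (Cmod (z - w)) gamma <= 4 * exp (gamma * s)).
    { pose proof (Cmod_minus_pos w z E) as Hm.
      apply Rle_trans with (Rpower (4 * exp s) gamma).
      - apply Rle_Rpower_l; lra.
      - unfold Rpower. rewrite ln_mult, ln_exp by (try apply exp_pos; lra).
        rewrite Rmult_plus_distr_l, exp_plus.
        apply Rmult_le_compat_r; [lra|].
        rewrite <- (exp_ln 4) at 2 by lra.
        assert (0 < ln 4) by (rewrite <- ln_1; apply ln_increasing; lra).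
        destruct (Req_dec (gamma * ln 4) (ln 4)) as [->|]; [lra|].
        left. apply exp_increasing. nra. }
    assert (Hp0 : 0 < Rpower (Cmod (z - w)) gamma) by apply exp_pos.
    pose proof (Rle_abs M). nra. }
  assert (Hweak : forall (f : R -> R -> R) l, (forall eps, 0 < eps -> exists S, S < 0 /\ S < S0 /\
      forall s t, s < S -> Rabs (f s t - l) <= eps) ->
    filterlim (fun st => f (fst st) (snd st)) polar_end (locally l)).
  { intros f l H. apply filterlim_polar_end_small. intros eps He.
    destruct (H eps He) as (S & _ & _ & HS). now exists S. }
  split; [|split; [|split; [|split; [|split]]]].
  - replace (/ sqrt k0) with (exp (- (ln k0 / 2))).
    + apply filterlim_ext_loc with (fun st => exp (U (fst st) (snd st) + ln (- fst st))).
      * exists 0. intros s t Hs. unfold U; simpl.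
        rewrite (exp_plus _ (ln (- s))), exp_ln by lra. ring.
      * apply filterlim_comp with (locally (- (ln k0 / 2))).
        -- apply (Hweak (fun s t => U s t + ln (- s))). intros eps He.
           destruct (asymptotic U _ _ _ _ _ k S0 k0 JU HperU HeqU Hk0 Hk HgrU eps He)
             as (S & HS1 & HS2 & HS).
           exists S. split; [easy|split; [easy|]]. intros s t Hs.
           replace (U s t + ln (- s) - - (ln k0 / 2)) with (U s t + (ln (- s) + ln k0 / 2))
             by ring. now apply HS.
        -- apply (continuity_pt_filterlim exp). apply derivable_continuous_pt, derivable_pt_exp.
    + rewrite exp_Ropp, <- (Rpower_sqrt k0) by easy. unfold Rpower.
      do 2 f_equal. field.
  - apply (Hweak (lp_s (fst p) (snd p) ux uy)). intros eps He.
    destruct (gradient_small U _ _ _ _ _ k S0 k0 JU HperU HeqU Hk0 Hk HgrU eps He)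
      as (S & HS1 & HS2 & HS).
    exists S. split; [easy|split; [easy|]]. intros s t Hs.
    destruct (HS s t Hs) as [K _].
    replace (lp_s (fst p) (snd p) ux uy s t - -1)
      with (lp_s (fst p) (snd p) ux uy s t + 1) by ring. exact K.
  - apply (Hweak (lp_t (fst p) (snd p) ux uy)). intros eps He.
    destruct (gradient_small U _ _ _ _ _ k S0 k0 JU HperU HeqU Hk0 Hk HgrU eps He)
      as (S & HS1 & HS2 & HS).
    exists S. split; [easy|split; [easy|]]. intros s t Hs.
    rewrite Rminus_0_r. now apply HS.
  - apply (Hweak (lp_ss (fst p) (snd p) ux uy uxx uxy uyy)). intros eps He.
    destruct (hessian_small U _ _ _ _ _ k S0 k0 JU HperU HeqU Hk0 Hk HgrU _ gamma Hgamma
      HholU eps He) as (S & HS1 & HS2 & HS).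
    exists S. split; [easy|split; [easy|]]. intros s t Hs.
    rewrite Rminus_0_r. now apply HS.
  - apply (Hweak (lp_st (fst p) (snd p) ux uy uxx uxy uyy)). intros eps He.
    destruct (hessian_small U _ _ _ _ _ k S0 k0 JU HperU HeqU Hk0 Hk HgrU _ gamma Hgamma
      HholU eps He) as (S & HS1 & HS2 & HS).
    exists S. split; [easy|split; [easy|]]. intros s t Hs.
    rewrite Rminus_0_r. now apply HS.
  - apply (Hweak (lp_tt (fst p) (snd p) ux uy uxx uxy uyy)). intros eps He.
    destruct (hessian_small U _ _ _ _ _ k S0 k0 JU HperU HeqU Hk0 Hk HgrU _ gamma Hgamma
      HholU eps He) as (S & HS1 & HS2 & HS).
    exists S. split; [easy|split; [easy|]]. intros s t Hs.
    rewrite Rminus_0_r. now apply HS.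
Qed.

(** * The three limits for the density *)

Lemma polar_minus p s t : (polar p s t - p)%C = (exp s * cos t, exp s * sin t).
Proof. apply injective_projections; simpl; ring. Qed.

Ltac polar_limits :=
  lazymatch goal with
  | |- filterlim (fun st => @?f st * @?g st) _ _ =>
      apply (filterlim_polar_end_mult f g); polar_limits
  | |- filterlim (fun st => @?f st + @?g st) _ _ =>
      apply (filterlim_polar_end_plus f g); polar_limits
  | |- filterlim (fun _ => ?c) _ _ => apply filterlim_const
  | |- _ => assumption
  end.

Theorem theorem4p1 (Omega : C -> Prop) (lambda : C -> R) (p : C)
    (kappa : C -> R)
    (hOmega : domain Omega)
    (hlambda : regular_metric Omega lambda)
    (hp : isolated_boundary_point Omega p)
    (* [kappa] is the extension of the curvature to [Omega] and [p] *)
    (hcurv : forall z, Omega z -> kappa z = curvature lambda z)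
    (hholder : holder_continuous_on (fun z => Omega z \/ z = p) kappa)
    (hneg : kappa p < 0)
    (horder : has_order (fun z => ln (lambda z)) p 1) :
  let L := fun z : C => RtoC (lambda z) in
  filterlim
    (fun z : C => ((z - p) * RtoC (Cmod (z - p))
                   * RtoC (ln (1 / Cmod (z - p))) * wirtinger L z)%C)
    (locally' p) (locally (RtoC (- (1 / (2 * sqrt (- kappa p)))))) /\
  filterlim
    (fun z : C => ((z - p) ^ 2 * RtoC (Cmod (z - p))
                   * RtoC (ln (1 / Cmod (z - p)))
                   * wirtinger (wirtinger L) z)%C)
    (locally' p) (locally (RtoC (3 / (4 * sqrt (- kappa p))))) /\
  filterlim
    (fun z : C => (RtoC (Cmod (z - p)) ^ 3
                   * RtoC (ln (1 / Cmod (z - p)))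
                   * wirtinger_bar (wirtinger L) z)%C)
    (locally' p) (locally (RtoC (1 / (4 * sqrt (- kappa p))))).
Proof.
  intros L.
  destruct hOmega as (Hop & _ & _). destruct hlambda as [Hpos HC2]. destruct hp as [_ Hloc].
  pose proof (open2_of_open Omega Hop) as HD2.
  destruct (C2_on_jet Omega lambda Hop HC2) as (lx & ly & lxx & lxy & lyy & JL).
  pose proof (C2_jet_ln _ _ _ _ _ _ _ HD2 JL (fun x y => Hpos (x, y))) as JU.
  set (ux := fun x y => / lambda (x, y) * lx x y) in JU.
  set (uy := fun x y => / lambda (x, y) * ly x y) in JU.
  set (uxx := fun x y => / lambda (x, y) * lxx x y
    - / lambda (x, y) * lx x y * (/ lambda (x, y) * lx x y)) in JU.
  set (uxy := fun x y => / lambda (x, y) * lxy x y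
    - / lambda (x, y) * lx x y * (/ lambda (x, y) * ly x y)) in JU.
  set (uyy := fun x y => / lambda (x, y) * lyy x y
    - / lambda (x, y) * ly x y * (/ lambda (x, y) * ly x y)) in JU.
  assert (Hdom : polar_end (fun st => Omega (polar p (fst st) (snd st)))).
  { destruct Hloc as [delta Hdelta].
    destruct (exp_small delta (cond_pos delta)) as (S0 & _ & HSd).
    exists S0. intros s t Hs. apply Hdelta; [|apply polar_neq].
    apply polar_ball. now apply HSd. }
  assert (Hexp2 : forall z, Omega z -> exp (2 * ln (lambda z)) = lambda z ^ 2).
  { intros z Hz. replace (2 * ln (lambda z)) with (ln (lambda z) + ln (lambda z)) by ring.
    rewrite exp_plus, exp_ln by now apply Hpos. ring. }
  destruct (singularity_limits Omega (fun z => ln (lambda z)) kappa p ux uy uxx uxy uyy)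
    as (LG & Ls & Lt & Lss & Lst & Ltt); trivial.
  { intros x y H. rewrite hcurv, Hexp2 by easy. unfold curvature.
    rewrite (laplacian_jet Omega _ _ _ _ _ _ (x, y) Hop JU H). simpl.
    field. specialize (Hpos _ H). lra. }
  (* [G] is [|z - p| ln (1 / |z - p|) lambda], the common factor of the three expressions, as
     [- s = ln (1 / |z - p|)]. *)
  set (G := fun st : R * R => - fst st * exp (ln (lambda (polar p (fst st) (snd st))) + fst st))
    in LG.
  assert (HG : forall s t, Omega (polar p s t) ->
    G (s, t) = - s * (lambda (polar p s t) * exp s)).
  { intros s t H. unfold G; simpl. now rewrite exp_plus, exp_ln by now apply Hpos. }
  assert (Hln : forall s, ln (1 / exp s) = - s).
  { intros s. unfold Rdiv. pose proof (exp_pos s).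
    now rewrite Rmult_1_l, ln_Rinv, ln_exp. }
  assert (Hsq : 0 < sqrt (- kappa p)) by (apply sqrt_lt_R0; lra).
  assert (Hl1 : forall x y, Omega (x, y) ->
    lx x y = lambda (x, y) * ux x y /\ ly x y = lambda (x, y) * uy x y).
  { intros x y H. specialize (Hpos _ H). unfold ux, uy. split; field; lra. }
  assert (Hl2 : forall x y, Omega (x, y) ->
    lxx x y = lambda (x, y) * (uxx x y + ux x y ^ 2) /\
    lxy x y = lambda (x, y) * (uxy x y + ux x y * uy x y) /\
    lyy x y = lambda (x, y) * (uyy x y + uy x y ^ 2)).
  { intros x y H. specialize (Hpos _ H). unfold ux, uy, uxx, uxy, uyy.
    repeat split; field; lra. }
  (* From here on the derivatives of [ln lambda] are opaque, so that [field] compares polynomials in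
     them. *)
  clearbody ux uy uxx uxy uyy.
  split; [|split].
  (* Real and imaginary parts of [G (u_s - i u_t) / 2]: in polar coordinates [(z - p) d/dz] is
     [(d/ds - i d/dt) / 2]. *)
  - apply (filterlim_polar p _ _
      (fun st => / 2 * (G st * lp_s (fst p) (snd p) ux uy (fst st) (snd st)))
      (fun st => / 2 * (G st * (-1 * lp_t (fst p) (snd p) ux uy (fst st) (snd st))))).
    + apply filter_imp with (2 := Hdom). intros [s t] H; cbn [fst snd] in *.
      rewrite HG by easy.
      rewrite Cmod_polar, Hln, polar_minus. unfold L.
      unfold polar in *. rewrite (wirtinger_real Omega lambda _ _ _ _ _ JL _ _ H).
      destruct (Hl1 _ _ H) as [-> ->]. unfold lp_s, lp_t, logpolar.
      apply injective_projections; simpl; field.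
    + replace (fst (RtoC _)) with (/ 2 * (/ sqrt (- kappa p) * -1)) by (simpl; field; lra).
      polar_limits.
    + replace (snd (RtoC _)) with (/ 2 * (/ sqrt (- kappa p) * (-1 * 0))) by (simpl; ring).
      polar_limits.
  (* With [T = (z - p) d/dz], the operator [(z - p)^2 d^2/dz^2] is [T^2 - T]; the components are
     those of [G (T^2 u - T u + (T u)^2)]. In the limit [T u = -1/2], which gives [1/2 + 1/4]. *)
  - apply (filterlim_polar p _ _
      (fun st => / 4 * (G st * (lp_ss (fst p) (snd p) ux uy uxx uxy uyy (fst st) (snd st)
        + -1 * lp_tt (fst p) (snd p) ux uy uxx uxy uyy (fst st) (snd st)
        + -2 * lp_s (fst p) (snd p) ux uy (fst st) (snd st)
        + lp_s (fst p) (snd p) ux uy (fst st) (snd st)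
          * lp_s (fst p) (snd p) ux uy (fst st) (snd st)
        + -1 * (lp_t (fst p) (snd p) ux uy (fst st) (snd st)
          * lp_t (fst p) (snd p) ux uy (fst st) (snd st)))))
      (fun st => / 4 * (G st * (-2 * lp_st (fst p) (snd p) ux uy uxx uxy uyy (fst st) (snd st)
        + 2 * lp_t (fst p) (snd p) ux uy (fst st) (snd st)
        + -2 * (lp_s (fst p) (snd p) ux uy (fst st) (snd st)
          * lp_t (fst p) (snd p) ux uy (fst st) (snd st)))))).
    + apply filter_imp with (2 := Hdom). intros [s t] H; cbn [fst snd] in *.
      rewrite HG by easy.
      rewrite Cmod_polar, Hln, polar_minus. unfold L.
      unfold polar in *. rewrite (wirtinger_wirtinger_real Omega lambda _ _ _ _ _ Hop JL _ _ H).
      destruct (Hl2 _ _ H) as (-> & -> & ->).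
      unfold lp_ss, lp_tt, lp_st, lp_s, lp_t, logpolar.
      apply injective_projections; simpl; field.
    + replace (fst (RtoC _)) with (/ 4 * (/ sqrt (- kappa p) * (0 + -1 * 0 + -2 * -1 + -1 * -1 + -1 * (0 * 0))))
        by (simpl; field; lra).
      polar_limits.
    + replace (snd (RtoC _)) with (/ 4 * (/ sqrt (- kappa p) * (-2 * 0 + 2 * 0 + -2 * (-1 * 0))))
        by (simpl; ring).
      polar_limits.
  (* [4 |z - p|^2] times the mixed Wirtinger derivative is [d^2/ds^2 + d^2/dt^2], and the product
     rule adds [u_s^2 + u_t^2], the only part that survives in the limit. The result is real. *)
  - apply (filterlim_polar p _ _
      (fun st => / 4 * (G st * (lp_ss (fst p) (snd p) ux uy uxx uxy uyy (fst st) (snd st)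
        + lp_tt (fst p) (snd p) ux uy uxx uxy uyy (fst st) (snd st)
        + lp_s (fst p) (snd p) ux uy (fst st) (snd st)
          * lp_s (fst p) (snd p) ux uy (fst st) (snd st)
        + lp_t (fst p) (snd p) ux uy (fst st) (snd st)
          * lp_t (fst p) (snd p) ux uy (fst st) (snd st))))
      (fun _ => 0)).
    + apply filter_imp with (2 := Hdom). intros [s t] H; cbn [fst snd] in *.
      rewrite HG by easy.
      rewrite Cmod_polar, Hln. unfold L.
      unfold polar in *.
      rewrite (wirtinger_bar_wirtinger_real Omega lambda _ _ _ _ _ Hop JL _ _ H).
      destruct (Hl2 _ _ H) as (-> & _ & ->).
      unfold lp_ss, lp_tt, lp_s, lp_t, logpolar.
      apply injective_projections; simpl; field [(sin_sq t)].
    + replace (fst (RtoC _)) with (/ 4 * (/ sqrt (- kappa p) * (0 + 0 + -1 * -1 + 0 * 0)))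
        by (simpl; field; lra).
      polar_limits.
    + apply filterlim_const.
Qed.
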